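(* Consider the stochastic variational inequality problem SVI$(X,F)$ with $F$ continuous and solution set $X^*\neq\emptyset$. Suppose that: (A1) for all $k\ge 0$, almost surely $\mathbb{E}[w_k\mid\mathcal F_k]=0$ and $\mathbb{E}[w_{k+1/2}\mid\mathcal F_{k+1/2}]=0$; (A2) there exists $\nu>0$ such that for all $k\ge 0$, almost surely $\mathbb{E}[\|w_k\|^2\mid\mathcal F_k]\le\nu^2$ and $\mathbb{E}[\|w_{k+1/2}\|^2\mid\mathcal F_{k+1/2}]\le\nu^2$; (A3) $\sum_{k=0}^\infty\gamma_k^2<\infty$; (A4) $\sum_{k=0}^\infty\gamma_k=\infty$; (A5) there exist $L,B>0$ such that $\|F(x)-F(y)\|\le L\|x-y\|$ and $\|F(x)\|\le B/2$ for all $x,y\in X$. Suppose in addition that one of the following holds: (i) $F$ satisfies the acute angle relation at $X^*$: $(x-x^* )^TF(x)>0$ for any $x\in X\setminus X^*$ and $x^*\in X^*$; (ii) $F$ is strictly pseudomonotone on $X$; (iii) $F$ is strongly pseudomonotone on $X$; (iv) $F$ is pseudomonotone on $X$ and is given by the gradient of $\mathbb{E}[f(x,\omega)]$. Then the extragradient scheme (ESA) generates a sequence $\{x_k\}$ such that, almost surely, $\{x_k\}$ is bounded and any limit point of $\{x_k\}$ is a solution of SVI$(X,F)$.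
   Context: Let $X\subseteq\mathbb{R}^n$ be nonempty, closed and convex, $\xi:\Omega\to\mathbb{R}^d$ a random vector on a probability space, $F(x;\omega):=F(x,\xi(\omega))\in\mathbb{R}^n$ and $F(x):=\mathbb{E}[F(x;\omega)]$ (componentwise). SVI$(X,F)$ is the problem of finding $x^*\in X$ with $(x-x^* )^TF(x^* )\ge 0$ for all $x\in X$; its solution set is $X^*$. $\Pi_X$ is Euclidean projection onto $X$ and $\|\cdot\|$ is the Euclidean norm. Extragradient stochastic approximation scheme (ESA): given $x_0\in X$ and a positive diminishing steplength sequence $\{\gamma_k\}$, for $k\ge 0$, $$x_{k+1/2}:=\Pi_X\big(x_k-\gamma_k(F(x_k)+w_k)\big),\qquad x_{k+1}:=\Pi_X\big(x_k-\gamma_k(F(x_{k+1/2})+w_{k+1/2})\big),$$ where $\omega_k,\omega_{k+1/2}$ are the samples drawn at iteration $k$, $w_k:=F(x_k;\omega_k)-F(x_k)$ and $w_{k+1/2}:=F(x_{k+1/2};\omega_{k+1/2})-F(x_{k+1/2})$. The histories are $\mathcal F_k:=\sigma\{x_0,\omega_0,\omega_{1/2},\omega_1,\dots,\omega_{k-1/2}\}$ and $\mathcal F_{k+1/2}:=\sigma(\mathcal F_k\cup\{\omega_k\})$. A continuous map $F$ is: pseudomonotone on $X$ if for all $x,y\in X$, $(x-y)^TF(y)\ge0\Rightarrow(x-y)^TF(x)\ge0$; strictly pseudomonotone on $X$ if for all $x\ne y$ in $X$, $(x-y)^TF(y)\ge0\Rightarrow(x-y)^TF(x)>0$; strongly pseudomonotone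 on $X$ if there exists $\sigma>0$ such that for all $x\neq y$ in $X$, $(x-y)^TF(y)\ge0\Rightarrow(x-y)^TF(x)\ge\sigma\|x-y\|^2$. *)

(* Defs.v *)
From HB Require Import structures.
From mathcomp Require Import all_boot all_order all_algebra.
From mathcomp Require Import all_classical all_reals all_analysis.
Import Order.TTheory GRing.Theory Num.Theory.
Import numFieldNormedType.Exports.

Set Implicit Arguments.
Unset Strict Implicit.
Unset Printing Implicit Defensive.

Local Open Scope classical_set_scope.
Local Open Scope ring_scope.

(* The library norm on 'rV[R]_n is the sup norm: it is used only for the
   topology and for boundedness, where the choice of norm is immaterial.
   Everything metric in the statement goes through edot and enorm. *)
Definition edot {R : realType} {n : nat} (u v : 'rV[R]_n) : R :=
  \sum_(i < n) u 0 i * v 0 i.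

Definition enorm {R : realType} {n : nat} (u : 'rV[R]_n) : R :=
  Num.sqrt (edot u u).

(* R^n with its Borel sigma-algebra ('rV[R]_n carries no measurable structure
   in the library). *)
Notation borelV R n := (g_sigma_algebraType (@open 'rV[R]_n)).

(* Euclidean projection; the minimizer exists and is unique when X is
   nonempty, closed and convex (the default value 0 is then never used). *)
Definition eproj {R : realType} {n : nat} (X : set 'rV[R]_n) (y : 'rV[R]_n) :
    'rV[R]_n :=
  xget 0 [set z | X z /\ forall u, X u -> enorm (y - z) <= enorm (y - u)].

Section variational_inequality.
Context {R : realType} {n : nat}.
Variables (X : set 'rV[R]_n) (F : 'rV[R]_n -> 'rV[R]_n).

Definition svi_sol : set 'rV[R]_n :=
  [set xs | X xs /\ forall x, X x -> 0 <= edot (x - xs) (F xs)].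

Definition acute_angle : Prop :=
  forall x xs, X x -> ~ svi_sol x -> svi_sol xs -> 0 < edot (x - xs) (F x).

Definition pseudomonotone : Prop :=
  forall x y, X x -> X y ->
    0 <= edot (x - y) (F y) -> 0 <= edot (x - y) (F x).

Definition strictly_pseudomonotone : Prop :=
  forall x y, X x -> X y -> x <> y ->
    0 <= edot (x - y) (F y) -> 0 < edot (x - y) (F x).

Definition strongly_pseudomonotone : Prop :=
  exists2 sigma : R, 0 < sigma &
    forall x y, X x -> X y -> x <> y ->
      0 <= edot (x - y) (F y) ->
      sigma * enorm (x - y) ^+ 2 <= edot (x - y) (F x).

Definition lipschitz_bounded : Prop :=
  exists L B : R, [/\ 0 < L, 0 < B,
    forall x y, X x -> X y -> enorm (F x - F y) <= L * enorm (x - y) &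
    forall x, X x -> enorm (F x) <= B / 2].

End variational_inequality.

Section conditional_expectation.
Context {R : realType} {dT : measure_display} {T : measurableType dT}.
Variable Q : probability T R.

(* Y is a version of E[Z | G], for a sub-sigma-algebra G given as a family of
   sets. *)
Definition is_cond_expectation (G : set (set T)) (Z Y : T -> R) : Prop :=
  [/\ Q.-integrable setT (EFin \o Z),
      Q.-integrable setT (EFin \o Y),
      (forall B : set R, measurable B -> G (Y @^-1` B)) &
      forall A, G A ->
        (\int[Q]_(t in A) (Z t)%:E = \int[Q]_(t in A) (Y t)%:E)%E].

(* "E[Z | G] satisfies S almost surely"; versions being almost surely equal,
   it does not matter which one is considered. *)
Definition cond_expectation_as (G : set (set T)) (Z : T -> R) (S : set R) :
    Prop :=
  exists2 Y : T -> R, is_cond_expectation G Z Y & {ae Q, forall t, S (Y t)}.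

End conditional_expectation.

Section mean.
Context {R : realType} {n : nat} {dO : measure_display} {Om : measurableType dO}.
Variables (P : probability Om R) (G : 'rV[R]_n -> Om -> 'rV[R]_n).

Definition mean_map (x : 'rV[R]_n) : 'rV[R]_n :=
  \row_(i < n) fine ('E_P[fun w => G x w 0%R i])%E.

(* The mean map is, on X, the gradient of x |-> E[f(x, .)].  As X may have
   empty interior, f(x, .) is required to be integrable on an open
   neighbourhood U of X, so that differentiability at the points of X makes
   sense. *)
Definition is_gradient_of_mean (X : set 'rV[R]_n) : Prop :=
  exists (f : 'rV[R]_n -> Om -> R) (U : set 'rV[R]_n),
    let g : 'rV[R]_n -> R^o := fun x => fine ('E_P[f x])%E in
    [/\ open U, X `<=` U,
        (forall x, U x -> P.-integrable setT (EFin \o f x)) &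
        forall x, X x ->
          differentiable g x /\ forall v, 'd g x v = edot (mean_map x) v].

End mean.

(* Two probability spaces occur: (Om, P), on which the random map G is given
   and against which F(x) = E[G(x, .)] is computed, and the space T on which the
   whole run of the scheme lives, i.e. the initial point x0 and the samples
   om k (written omega_k in the mathematics) and omh k (omega_{k+1/2}). *)
Section extragradient.
Context {R : realType} {n : nat} {dO : measure_display} {Om : measurableType dO}.
Variables (P : probability Om R) (X : set 'rV[R]_n).
Variables (G : 'rV[R]_n -> Om -> 'rV[R]_n) (gamma : nat -> R).
Context {dT : measure_display} {T : measurableType dT}.
Variables (x0 : T -> 'rV[R]_n) (om omh : nat -> T -> Om).

Local Notation Fm := (mean_map P G).

Definition sample_error (x : 'rV[R]_n) (w : Om) : 'rV[R]_n := G x w - Fm x.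

(* Pi_X (x - gamma_k (F(z) + (F(z; w) - F(z)))) *)
Definition esa_move (k : nat) (x z : 'rV[R]_n) (w : Om) : 'rV[R]_n :=
  eproj X (x - gamma k *: (Fm z + sample_error z w)).

Fixpoint esa (k : nat) (t : T) {struct k} : 'rV[R]_n :=
  match k with
  | 0%N => x0 t
  | j.+1 =>
      let x := esa j t in
      esa_move j x (esa_move j x x (om j t)) (omh j t)
  end.

Definition esa_half (k : nat) (t : T) : 'rV[R]_n :=
  esa_move k (esa k t) (esa k t) (om k t).

Definition esa_noise (k : nat) (t : T) : 'rV[R]_n :=
  sample_error (esa k t) (om k t).

Definition esa_noise_half (k : nat) (t : T) : 'rV[R]_n :=
  sample_error (esa_half k t) (omh k t).

Definition history (k : nat) : set (set T) :=
  <<s preimage_set_system setT (x0 : T -> borelV R n) measurable `|`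
      \bigcup_(j < k) (preimage_set_system setT (om j) measurable `|`
                       preimage_set_system setT (omh j) measurable) >>.

Definition history_half (k : nat) : set (set T) :=
  <<s history k `|` preimage_set_system setT (om k) measurable >>.

End extragradient.

(* Main.v *)
Require Import Defs.
From HB Require Import structures.
From mathcomp Require Import all_boot all_order all_algebra.
From mathcomp Require Import all_classical all_reals all_analysis.
From mathcomp Require Import measurable_realfun ring lra.
Import Order.TTheory GRing.Theory Num.Theory.
Import numFieldNormedType.Exports.

Local Open Scope classical_set_scope.
Local Open Scope ring_scope.

(** Fix a solution [xs] and write [a k] for the squared Euclidean distance from
    the iterate [x k] to [xs]. Since the projection is nonexpansive and [F] is
    Lipschitz and bounded, one iteration with errors [w] and [w'] satisfies
      [a k.+1 <= (1 + gamma k ^+ 2) * a k - 2 * gamma k * b k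
                 - 2 * gamma k * edot (x k - xs) w' + c k],
    where [b k = edot (x k - xs) (F (x k))] and [c k] is [gamma k ^+ 2] times a
    constant plus a multiple of the squared errors ([extragradient_step]). Each
    of the four monotonicity hypotheses implies the acute angle relation; for a
    pseudomonotone gradient map this is because its potential is pseudoconvex
    ([pseudomonotone_gradient_acute]). In turn the acute angle relation and
    continuity give [b k >= 0] everywhere on [X] ([acute_angle_ge0]).

    All the randomness is handled by one convergence theorem: for a bounded
    measurable function [phi] of the current iterate, the martingale with
    increments [gamma k * phi (x k) * w' k] converges almost surely, because
    the second moments of its increments are summable ([martingale_cvg], proved
    with a maximal inequality for stopped sums; [ae_noise_cvg]). Taking only
    bounded weights avoids any integrability assumption on the initial point.
    Three families of weights are used, and the rest of the argument is
    deterministic, on one trajectory.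
    - With weight [(x k - xs) / (1 + a k)], the basic inequality, divided by
      [1 + a k], bounds the products of the factors by which [1 + a k] grows;
      so the trajectory is bounded ([run_bounded]).
    - With constant weights and with truncated coordinates, the truncation being
      inactive on a bounded trajectory for a large level, the noise series
      [sum gamma k * edot (x k - z) w'] converges for every [z] at once. Hence,
      for every solution [z] and on the same event, the distance from [x k] to
      [z] converges and [sum gamma k * edot (x k - z) (F (x k))] is finite
      ([run_quasi_fejer]).
    Since [sum gamma k] diverges, [b] tends to [0] along a subsequence; a limit
    point [z] of it satisfies [edot (z - xs) (F z) = 0], so it is a solution by
    the acute angle relation. The distance from [x k] to [z] converges, and
    tends to [0] along a subsequence: the whole sequence converges to the
    solution [z] ([run_limit]). *)

(** * Euclidean geometry and the projection onto a closed convex set *)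

Section euclidean.
Context {R : realType} {n : nat}.
Implicit Types u v w : 'rV[R]_n.

Lemma edotC u v : edot u v = edot v u.
Proof. by apply: eq_bigr => i _; rewrite mulrC. Qed.

Lemma edotDl u v w : edot (u + v) w = edot u w + edot v w.
Proof. by rewrite -big_split; apply: eq_bigr => i _; rewrite mxE mulrDl. Qed.

Lemma edotZl (a : R) u v : edot (a *: u) v = a * edot u v.
Proof. by rewrite mulr_sumr; apply: eq_bigr => i _; rewrite mxE mulrA. Qed.

Lemma edotNl u v : edot (- u) v = - edot u v.
Proof. by rewrite -scaleN1r edotZl mulN1r. Qed.

Lemma edotBl u v w : edot (u - v) w = edot u w - edot v w.
Proof. by rewrite edotDl edotNl. Qed.

Lemma edotDr u v w : edot w (u + v) = edot w u + edot w v.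
Proof. by rewrite edotC edotDl !(edotC w). Qed.

Lemma edotZr (a : R) u v : edot v (a *: u) = a * edot v u.
Proof. by rewrite edotC edotZl edotC. Qed.

Lemma edotNr u v : edot v (- u) = - edot v u.
Proof. by rewrite edotC edotNl edotC. Qed.

Lemma edotBr u v w : edot w (u - v) = edot w u - edot w v.
Proof. by rewrite edotDr edotNr. Qed.

Definition edotE := (edotDl, edotDr, edotNl, edotNr, edotZl, edotZr).

Lemma edot_ge0 u : 0 <= edot u u.
Proof. by apply: sumr_ge0 => i _; rewrite -expr2 sqr_ge0. Qed.

Lemma sqr_enorm u : enorm u ^+ 2 = edot u u.
Proof. by rewrite /enorm sqr_sqrtr// edot_ge0. Qed.

Lemma ler_enorm u v : (enorm u <= enorm v) = (edot u u <= edot v v).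
Proof. by rewrite /enorm ler_sqrt// edot_ge0. Qed.

Lemma edot_le_half u v : 2 * edot u v <= edot u u + edot v v.
Proof. by have := edot_ge0 (u - v); rewrite !edotE (edotC v u); lra. Qed.

Lemma edotDD_le u v : edot (u + v) (u + v) <= 2 * (edot u u + edot v v).
Proof. by have := edot_le_half u v; rewrite !edotE (edotC v u); lra. Qed.

Lemma sqr_coord_le_edot u i : u 0 i ^+ 2 <= edot u u.
Proof.
rewrite /edot (bigD1 i)//= -expr2 lerDl.
by apply: sumr_ge0 => j _; rewrite -expr2 sqr_ge0.
Qed.

(** The sup norm is dominated by the Euclidean norm. *)
Lemma sqr_norm_le_edot u : `|u| ^+ 2 <= edot u u.
Proof.
have [->|/mx_norm_neq0[[i j] /= unE]] := eqVneq (`|u|) 0.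
  by rewrite expr0n /= edot_ge0.
have -> : `|u| = `|u i j| by exact: unE.
by rewrite ord1 -normrX ger0_norm ?sqr_ge0// sqr_coord_le_edot.
Qed.

Lemma cvg_edot {T : Type} {F : set_system T} {FF : Filter F}
    (f g : T -> 'rV[R]_n) u v :
  f @ F --> u -> g @ F --> v -> (fun t => edot (f t) (g t)) @ F --> edot u v.
Proof.
move=> fu gv; apply: cvg_big => [|i _]; first exact: add_continuous.
apply: cvgM.
  apply: (cvg_comp f (fun M : 'rV[R]_n => M 0 i) fu).
  exact: (@coord_continuous R 1 n 0 i u).
apply: (cvg_comp g (fun M : 'rV[R]_n => M 0 i) gv).
exact: (@coord_continuous R 1 n 0 i v).
Qed.

Lemma edot_cvg0 {T : Type} {F : set_system T} {FF : Filter F}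
    (f : T -> 'rV[R]_n) u :
  (fun t => edot (f t - u) (f t - u)) @ F --> (0 : R) -> f @ F --> u.
Proof.
move=> /cvgrPdist_lt f0; apply/cvgrPdist_lt => e e0.
have /f0 : 0 < e ^+ 2 by rewrite exprn_gt0.
apply: filterS => t; rewrite sub0r normrN ger0_norm ?edot_ge0// => lte.
rewrite distrC -(ltr_pXn2r (n := 2))// ?nnegrE ?normr_ge0 ?ltW//.
exact: le_lt_trans (sqr_norm_le_edot _) _.
Qed.

Lemma cvg_sqdist {T : Type} {F : set_system T} {FF : Filter F}
    (f : T -> 'rV[R]_n) u v : f @ F --> u ->
  (fun t => edot (f t - v) (f t - v)) @ F --> edot (u - v) (u - v).
Proof.
move=> fu; have fuv : (fun t => f t - v) @ F --> u - v.
  by apply: cvgB => //; exact: cvg_cst.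
exact: (cvg_edot _ _ _ _ fuv fuv).
Qed.

Lemma continuous_sqdist v : continuous (fun u => edot (u - v) (u - v)).
Proof.
move=> u; apply: (@cvg_sqdist _ (nbhs u) (nbhs_filter u) id u v).
exact: cvg_id.
Qed.

Lemma edotBZ (s : R) u v : edot (u - s *: v) (u - s *: v) =
  edot u u - 2 * s * edot u v + s ^+ 2 * edot v v.
Proof. by rewrite !edotE (edotC v u); ring. Qed.

Lemma edotNN u v : edot (- u) (- v) = edot u v.
Proof. by rewrite edotNl edotNr opprK. Qed.

Lemma edot0 : edot (0 : 'rV[R]_n) 0 = 0.
Proof. by rewrite -(scale0r 0) edotZl mul0r. Qed.

End euclidean.

Section projection.
Context {R : realType} {n : nat} (X : set 'rV[R]_n).
Hypotheses (X0 : X !=set0) (Xcl : closed X) (Xconv : convex_set X).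
Implicit Types u v x y z : 'rV[R]_n.

Lemma convex_set_segment x y (s : R) : 0 <= s <= 1 -> X x -> X y ->
  X (x + s *: (y - x)).
Proof.
move=> /andP[s0 s1] Xx Xy.
have := Xconv y x (Itv01 s0 s1); rewrite !inE => /(_ Xy Xx).
have -> : x + s *: (y - x) = s *: y + (1 - s) *: x.
  by rewrite scalerBl scale1r scalerBr addrCA.
by [].
Qed.

Lemma eproj_spec y : X (eproj X y) /\
  forall u, X u -> edot (y - eproj X y) (y - eproj X y) <= edot (y - u) (y - u).
Proof.
suff [z Xz zmin] : exists2 z, X z &
    forall u, X u -> edot (y - z) (y - z) <= edot (y - u) (y - u).
  have [|Xp pmin] := @xgetPex _ 0 [set z | X z /\
      forall u, X u -> enorm (y - z) <= enorm (y - u)].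
    by exists z; split => // u /zmin; rewrite ler_enorm.
  by split=> // u /pmin; rewrite ler_enorm.
have [u0 Xu0] := X0.
pose r := edot (y - u0) (y - u0).
pose f z := edot (y - z) (y - z).
have fcont : continuous f.
  have -> : f = fun z => edot (z - y) (z - y).
    by apply/funext => z; rewrite /f -opprB edotNN.
  exact: continuous_sqdist.
pose A := X `&` [set z | f z <= r].
have [|||z /[!inE] -[Xz zr] zmin] := @compact_EVT_min _ R f A.
- by exists u0; split => //=; rewrite /f.
- apply: bounded_closed_compact.
    exists (`|y| + (1 + r)); split; first exact: num_real.
    move=> M ltM z [Xz /= fz]; apply: le_trans (ltW ltM).
    rewrite -lerBlDl; have yz : `|z| - `|y| <= `|y - z|.
      by rewrite distrC; exact: lerB_dist.
    apply: le_trans yz _.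
    have := le_trans (sqr_norm_le_edot (y - z)) fz.
    have := sqr_ge0 (`|y - z| - 1); have := normr_ge0 (y - z).
    by nra.
  apply: closedI => //.
  have -> : [set z | f z <= r] = f @^-1` [set t | t <= r] by [].
  by apply: closed_comp => [z _|]; [exact: fcont|exact: closed_le].
- exact: continuous_subspaceT.
exists z => // u Xu.
have [ur|ru] := leP (f u) r; last exact: le_trans zr (ltW ru).
by apply: zmin; rewrite inE.
Qed.

Lemma eproj_in y : X (eproj X y). Proof. by have [] := eproj_spec y. Qed.

(** The variational characterization of the projection: seen from the
    projection of [y], no point of [X] makes an acute angle with [y]. *)
Lemma eproj_obtuse y u : X u -> edot (y - eproj X y) (u - eproj X y) <= 0.
Proof.
have [Xp pmin] := eproj_spec y; set p := eproj X y in Xp pmin * => Xu.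
have [//|gt0] := leP (edot (y - p) (u - p)) 0.
set a := edot (y - p) (u - p) in gt0 *.
set b := edot (u - p) (u - p).
have b0 : 0 <= b by exact: edot_ge0.
(* if [a > 0], moving from [p] towards [u] by the fraction [s] changes the
   squared distance to [y] by [- 2 s a + s^2 b], negative as [s b < a] *)
pose s := a / (a + b).
have ab0 : 0 < a + b by rewrite ltr_wpDr.
have s01 : 0 <= s <= 1.
  by rewrite divr_ge0 ?(ltW gt0) ?(ltW ab0)//= ler_pdivrMr// mul1r lerDl.
have s0 : 0 < s by rewrite divr_gt0.
have sab : s * (a + b) = a by rewrite /s mulfVK// gt_eqF.
have := pmin _ (convex_set_segment _ _ s s01 Xp Xu).
rewrite opprD addrA.
have -> : edot (y - p - s *: (u - p)) (y - p - s *: (u - p)) =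
    edot (y - p) (y - p) - 2 * s * a + s ^+ 2 * b.
  by rewrite edotBZ.
move=> hmin; have : 0 <= s * (s * b - 2 * a) by rewrite -/a -/b in hmin; lra.
rewrite pmulr_rge0// => sb; have sa : 0 < s * a by rewrite mulr_gt0.
by lra.
Qed.

Lemma eproj_id y : X y -> eproj X y = y.
Proof.
move=> Xy; have := eproj_obtuse y y Xy => le0.
have /eqP : `|y - eproj X y| ^+ 2 = 0.
  apply/eqP; rewrite eq_le sqr_ge0 andbT; apply: le_trans le0.
  exact: sqr_norm_le_edot.
by rewrite sqrf_eq0 normr_eq0 subr_eq0 => /eqP.
Qed.

Lemma eproj_nonexpansive x y :
  edot (eproj X x - eproj X y) (eproj X x - eproj X y) <= edot (x - y) (x - y).
Proof.
set p := eproj X x; set q := eproj X y.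
have hx : edot (x - p) (q - p) <= 0 by exact: eproj_obtuse _ _ (eproj_in y).
have hy : edot (y - q) (p - q) <= 0 by exact: eproj_obtuse _ _ (eproj_in x).
have := edot_le_half (x - y) (p - q).
clearbody p q.
have : edot (x - y - (p - q)) (p - q) =
    - edot (x - p) (q - p) - edot (y - q) (p - q).
  have -> : - edot (x - p) (q - p) = edot (x - p) (p - q).
    by rewrite -edotNr opprB.
  rewrite -edotBl; congr (edot _ _).
  by rewrite !opprB addrACA [RHS]addrACA; congr (_ + _); rewrite addrC.
by rewrite edotBl; lra.
Qed.

Lemma cvg_eproj {T : Type} {F : set_system T} {FF : Filter F}
    (f : T -> 'rV[R]_n) y :
  f @ F --> y -> (fun t => eproj X (f t)) @ F --> eproj X y.
Proof.
move=> fy; apply: edot_cvg0.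
have := @cvg_sqdist R n T F FF f y y fy.
rewrite subrr edot0; apply: squeeze_cvgr; last exact: cvg_cst.
by apply: nearW => t; rewrite edot_ge0/= eproj_nonexpansive.
Qed.

Lemma eproj_continuous : continuous (eproj X).
Proof.
move=> y; apply: (@cvg_eproj _ (nbhs y) (nbhs_filter y) id y).
exact: cvg_id.
Qed.

End projection.

(** * Solutions of variational inequalities and generalized monotonicity *)

Section svi.
Context {R : realType} {n : nat} (X : set 'rV[R]_n) (F : 'rV[R]_n -> 'rV[R]_n).
Hypotheses (Xconv : convex_set X) (Fc : {within X, continuous F}).
Implicit Types x y z : 'rV[R]_n.

Lemma within_continuous_cvg (z : nat -> 'rV[R]_n) x : X x ->
  (forall k, X (z k)) -> z @ \oo --> x -> (F \o z) @ \oo --> F x.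
Proof.
move=> Xx Xz zx; have /subspace_continuousP/(_ _ Xx) Fx := Fc.
have zw : z @ \oo --> within X (nbhs x).
  move=> A /zx zA; have : \forall k \near \oo, X (z k) -> A (z k) by exact: zA.
  by apply: filterS => k /(_ (Xz k)).
exact: cvg_comp zw Fx.
Qed.

(** The acute angle relation says nothing at the solutions, but there the angle
    is not obtuse either: an inner point of the segment from [xs] to [x] is
    either covered by the relation, or a solution, which can be tested against
    [x]; the endpoint [x] is reached by continuity. *)
Lemma acute_angle_ge0 x xs : acute_angle X F -> X x -> svi_sol X F xs ->
  0 <= edot (x - xs) (F x).
Proof.
move=> acute Xx xsol; have [Xxs _] := xsol.
(* the offset [k.+2] keeps [s k] in the open interval ]0, 1[ *)
pose s k : R := 1 - k.+2%:R^-1.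
pose z k := xs + s k *: (x - xs).
have s0 k : 0 < s k by rewrite subr_gt0 invf_lt1// ltr1n.
have s1 k : 0 < 1 - s k by rewrite subKr invr_gt0.
have Xz k : X (z k).
  by apply: convex_set_segment => //; rewrite (ltW (s0 k))/= -subr_ge0 ltW.
have sc : s @ \oo --> (1 : R).
  rewrite -[X in _ --> X](subr0 1); apply: cvgB; first exact: cvg_cst.
  have := @cvg_harmonic R; rewrite -(cvg_shiftS (@harmonic R)); exact.
have zx : z @ \oo --> x.
  rewrite -[X in _ --> X](subrK xs) addrC -[X in _ + X]scale1r.
  apply: cvgD; first exact: cvg_cst.
  by apply: cvgZr_tmp.
have Fz := within_continuous_cvg _ _ Xx Xz zx.
have lim : (fun k => edot (x - xs) (F (z k))) @ \oo --> edot (x - xs) (F x).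
  by apply: cvg_edot => //; exact: cvg_cst.
apply: (cvgr_to_ge lim).
apply: nearW => k.
have [[_ zsol]|zsol] := pselect (svi_sol X F (z k)).
  have := zsol _ Xx; have -> : x - z k = (1 - s k) *: (x - xs).
    by rewrite [RHS]scalerBl scale1r opprD addrA.
  by rewrite edotZl pmulr_rge0.
have := acute _ _ (Xz k) zsol xsol.
rewrite /z addrAC subrr add0r edotZl pmulr_rgt0//; exact: ltW.
Qed.

Lemma strictly_pseudomonotone_acute :
  strictly_pseudomonotone X F -> acute_angle X F.
Proof.
move=> sm x xs Xx xnsol xsol; have [Xxs xsP] := xsol.
by apply: sm => //; [move=> xE; apply: xnsol; rewrite xE|exact: xsP].
Qed.

Lemma strongly_pseudomonotone_strictly :
  strongly_pseudomonotone X F -> strictly_pseudomonotone X F.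
Proof.
move=> [sg sg0 sm] x y Xx Xy xy xy0; apply: lt_le_trans (sm _ _ Xx Xy xy xy0).
rewrite mulr_gt0// sqr_enorm lt_neqAle edot_ge0 andbT eq_sym.
apply/negP => /eqP d0; apply: xy; apply/eqP.
rewrite -subr_eq0 -normr_eq0 -(sqrf_eq0 `|x - y|) eq_le sqr_ge0 andbT -d0.
exact: sqr_norm_le_edot.
Qed.

(** The map [F] is, on [X], the gradient of the function [g]. *)
Section gradient.
Variable g : 'rV[R]_n -> R^o.
Hypothesis gF : forall x, X x ->
  differentiable g x /\ forall v, 'd g x v = edot (F x) v.

(** The mean value theorem for [g] along a segment of [X]. *)
Lemma gradient_mean_value x y : X x -> X y ->
  exists2 s : R, 0 < s < 1 &
    g y - g x = edot (F (x + s *: (y - x))) (y - x).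
Proof.
move=> Xx Xy; pose h (s : R) : R := g (x + s *: (y - x)).
pose dh s := edot (F (x + s *: (y - x))) (y - x).
have hder (s : R) : 0 <= s <= 1 -> is_derive s 1 h (dh s).
  move=> s01; have [gd gE] := gF _ (convex_set_segment _ Xconv _ _ _ s01 Xx Xy).
  have hE : (fun t : R => t^-1 *: ((h \o shift s) (t *: 1) - h s)) =
      (fun t => t^-1 *: ((g \o shift (x + s *: (y - x))) (t *: (y - x)) -
                         g (x + s *: (y - x)))).
    apply/funext => t; rewrite /h /= [t *: 1]mulr1 scalerDl addrCA.
    by [].
  split.
    by rewrite /derivable hE; exact: diff_derivable.
  by rewrite /derive hE -[LHS]/('D_(y - x) g (x + s *: (y - x))) deriveE.
have [||s] := @MVT R h dh 0 1 ltr01.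
- by move=> s; rewrite in_itv/= => /andP[s0 s1]; apply: hder; rewrite !ltW.
- apply: derivable_within_continuous => s; rewrite in_itv/= => s01.
  by have [] := hder _ s01.
rewrite in_itv/= => s01.
have -> : h 1 = g y by rewrite /h scale1r addrC subrK.
have -> : h 0 = g x by rewrite /h scale0r addr0.
by rewrite subr0 mulr1 => ->; exists s.
Qed.

(** The potential [g] of a pseudomonotone gradient map is pseudoconvex: if the
    derivative of [g] at [x] towards [y] is nonnegative, then [g x <= g y]. *)
Lemma pseudomonotone_gradient_le x y : pseudomonotone X F -> X x -> X y ->
  0 <= edot (y - x) (F x) -> g x <= g y.
Proof.
move=> pm Xx Xy yx0; have [s /andP[s0 s1] gE] := gradient_mean_value _ _ Xx Xy.
rewrite -subr_ge0 gE edotC.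
have Xz : X (x + s *: (y - x)).
  by apply: convex_set_segment => //; rewrite !ltW.
have := pm _ _ Xz Xx; rewrite addrAC subrr add0r !edotZl !pmulr_rge0//.
exact.
Qed.

Lemma minimizer_svi_sol x : X x -> (forall y, X y -> g x <= g y) ->
  svi_sol X F x.
Proof.
move=> Xx xmin; split=> // y Xy.
(* by the mean value theorem, points [x + t *: (y - x)] of the segment with [t]
   arbitrarily small at which [F] does not make an obtuse angle with [y - x] *)
have ex k : exists t : R, 0 <= t <= k.+1%:R^-1 /\
    0 <= edot (y - x) (F (x + t *: (y - x))).
  pose r : R := k.+1%:R^-1.
  have r0 : 0 < r by rewrite invr_gt0.
  have r1 : r <= 1 by rewrite invf_le1 ?ler1n.
  have Xw : X (x + r *: (y - x)).
    by apply: convex_set_segment => //; rewrite (ltW r0).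
  have [s /andP[s0 s1] gE] := gradient_mean_value _ _ Xx Xw.
  exists (s * r); split.
    by rewrite mulr_ge0 ?(ltW s0) ?(ltW r0)//= ler_piMl ?(ltW s1) ?(ltW r0).
  have := xmin _ Xw; rewrite -subr_ge0 gE [_ + r *: _ - x]addrAC subrr add0r.
  by rewrite scalerA edotZr pmulr_rge0// edotC.
have [t tP] := choice ex.
pose z k := x + t k *: (y - x).
have Xz k : X (z k).
  apply: convex_set_segment => //; have [/andP[-> tk] _] := tP k.
  by rewrite (le_trans tk)// invf_le1 ?ler1n.
have tc : t @ \oo --> (0 : R).
  apply: squeeze_cvgr (cvg_cst (0 : R)) (@cvg_harmonic R).
  by apply: nearW => k; have [] := tP k.
have zx : z @ \oo --> x.
  rewrite -[X in _ --> X]addr0 -(scale0r (y - x)).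
  apply: cvgD; first exact: cvg_cst.
  by apply: cvgZr_tmp.
have Fz := within_continuous_cvg _ _ Xx Xz zx.
have lim : (fun k => edot (y - x) (F (z k))) @ \oo --> edot (y - x) (F x).
  by apply: cvg_edot => //; exact: cvg_cst.
apply: (cvgr_to_ge lim).
by apply: nearW => k; have [] := tP k.
Qed.

Lemma pseudomonotone_gradient_acute : pseudomonotone X F -> acute_angle X F.
Proof.
(* if the angle at [x] were right, then [g x <= g xs], so [x] would minimize [g]
   as [xs] does, and would be a solution *)
move=> pm x xs Xx xnsol [Xxs xsol].
rewrite lt_neqAle (pm _ _ Xx Xxs (xsol _ Xx)) andbT eq_sym.
apply/negP => /eqP x0; apply: xnsol; apply: minimizer_svi_sol => // y Xy.
apply: (@le_trans _ _ (g xs)).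
  by apply: pseudomonotone_gradient_le => //; rewrite -opprB edotNl x0 oppr0.
by apply: pseudomonotone_gradient_le => //; exact: xsol.
Qed.

End gradient.
End svi.

(** * Real sequences and series *)

Section real_sequences.
Context {R : realType}.
Implicit Types a b u : nat -> R.

Lemma cvgn_bounded u : cvgn u -> exists2 M : R, 0 <= M & forall k, `|u k| <= M.
Proof.
move=> /cvg_has_ub[M uM]; have ub k : `|u k| <= M by apply: uM; exists k.
by exists M => //; exact: le_trans (normr_ge0 (u 0%N)) (ub 0%N).
Qed.

Lemma seriesS_eq u k : series u k.+1 = series u k + u k.
Proof. by rewrite seriesSr addrC. Qed.

Lemma series0_eq u : series u 0%N = 0.
Proof. by rewrite /series/= big_geq. Qed.

Lemma is_cvg_series_sum {I : Type} (r : seq I) (f : I -> nat -> R) :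
  (forall i, cvgn (series (f i))) ->
  cvgn (series (fun k => \sum_(i <- r) f i k)).
Proof.
move=> fc; elim: r => [|i r IH].
  have -> : series (fun k => \sum_(i <- [::]) f i k) = cst 0.
    by apply/funext => k; rewrite /series/= big1// => j _; rewrite big_nil.
  exact: is_cvg_cst.
have -> : (fun k => \sum_(j <- i :: r) f j k) =
    f i + (fun k => \sum_(j <- r) f j k).
  by apply/funext => k; rewrite big_cons fctE.
exact: is_cvg_seriesD.
Qed.

(** A deterministic counterpart of the Robbins-Siegmund lemma. The
    perturbations [u] may have any sign; their series need not converge
    absolutely. *)
Lemma almost_decreasing_cvg a b u :
  (forall k, 0 <= a k) -> (forall k, 0 <= b k) ->
  (forall k, a k.+1 <= a k - b k + u k) -> cvgn (series u) ->
  cvgn a /\ cvgn (series b).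
Proof.
move=> a0 b0 aS uc; have [M M0 uM] := cvgn_bounded _ uc.
have uM' k : - M <= series u k <= M by rewrite -ler_norml.
split.
  have -> : a = (fun k => a k - series u k) + series u.
    by apply/funext => k; rewrite fctE subrK.
  apply: is_cvgD => //; apply: (@nonincreasing_is_cvgn R).
    apply/nonincreasing_seqP => k; rewrite seriesS_eq.
    by have := aS k; have := b0 k; lra.
  exists (- M) => _ [k _ <-].
  by have /andP[_] := uM' k; have := a0 k; lra.
apply: (@nondecreasing_is_cvgn R).
  by apply/nondecreasing_seqP => k; rewrite seriesS_eq lerDl.
exists (a 0%N + M) => _ [k _ <-].
have : a k + series b k <= a 0%N + series u k.
  elim: k => [|k IH]; first by rewrite !series0_eq.
  by rewrite !seriesS_eq; have := aS k; lra.
by have := a0 k; have /andP[_] := uM' k; lra.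
Qed.

(** A multiplicative perturbation with convergent series keeps a sequence
    bounded, because [1 + u <= expR u]. *)
Lemma multiplicative_bounded a u : (forall k, 0 <= a k) ->
  (forall k, 1 + a k.+1 <= (1 + a k) * (1 + u k)) -> cvgn (series u) ->
  exists M : R, forall k, a k <= M.
Proof.
move=> a0 aS uc; have [M M0 uM] := cvgn_bounded _ uc.
have aE k : 1 + a k <= (1 + a 0%N) * expR (series u k).
  elim: k => [|k IH]; first by rewrite series0_eq expR0 mulr1.
  rewrite seriesS_eq expRD mulrA; apply: le_trans (aS k) _.
  apply: (@le_trans _ _ ((1 + a k) * expR (u k))).
    by rewrite ler_wpM2l ?expR_ge1Dx// addr_ge0.
  by rewrite ler_wpM2r ?expR_ge0.
exists ((1 + a 0%N) * expR M) => k.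
apply: (@le_trans _ _ (1 + a k)); first by rewrite lerDr.
apply: le_trans (aE k) _; rewrite ler_wpM2l ?addr_ge0// ler_expR.
exact: le_trans (ler_norm _) (uM k).
Qed.

(** If [sum g = +oo] and [sum g b < +oo], then [liminf b = 0]. *)
Lemma frequently_small (g b : nat -> R) : (forall k, 0 <= g k) ->
  (forall k, 0 <= b k) -> ~ cvgn (series g) ->
  cvgn (series (fun k => g k * b k)) ->
  forall (e : R) (m : nat), 0 < e -> exists2 k, (m <= k)%N & b k < e.
Proof.
move=> g0 b0 gd gbc e m e0; apply: contrapT => small; apply: gd.
have big k : (m <= k)%N -> e <= b k.
  by move=> mk; rewrite leNgt; apply/negP => lt; apply: small; exists k.
have [M M0 gbM] := cvgn_bounded _ gbc.
have nd : nondecreasing_seq (series g).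
  by apply/nondecreasing_seqP => k; rewrite seriesS_eq lerDl.
apply: (nondecreasing_is_cvgn nd).
exists (series g m + e^-1 * M) => _ [k _ <-].
suff : series g k <= series g m + e^-1 * series (fun k => g k * b k) k.
  move=> le_k; apply: le_trans le_k _.
  rewrite lerD2l ler_wpM2l ?invr_ge0 ?(ltW e0)//.
  exact: le_trans (ler_norm _) (gbM k).
have s0 j : 0 <= e^-1 * series (fun k => g k * b k) j.
  rewrite mulr_ge0 ?invr_ge0 ?(ltW e0)// /series/= sumr_ge0// => i _.
  exact: mulr_ge0.
have [km|mk] := leqP k m; first by apply: ler_wpDr => //; exact: nd.
rewrite -(subnKC (ltnW mk)); elim: (k - m)%N => [|j IH].
  by rewrite addn0 lerDl.
rewrite addnS !seriesS_eq mulrDr addrA; apply: lerD => //.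
by rewrite mulrC -mulrA ler_peMr// ler_pdivlMr// mul1r big// leq_addr.
Qed.

End real_sequences.

(** * Pathwise convergence of the extragradient scheme *)

(** The vector [u] with its coordinates truncated at [- N] and [N]. *)
Definition clamp {R : realType} {n : nat} (N : R) (u : 'rV[R]_n) : 'rV[R]_n :=
  \row_i Num.max (- N) (Num.min N (u 0 i)).

(** The vector [u - xs], scaled down to a bounded function of [u]. *)
Definition damped {R : realType} {n : nat} (xs u : 'rV[R]_n) : 'rV[R]_n :=
  (1 + edot (u - xs) (u - xs))^-1 *: (u - xs).

Lemma le1D_of_sqr_le {R : realType} (t K : R) : t ^+ 2 <= K -> t <= 1 + K.
Proof. by have := sqr_ge0 (t - 1); rewrite expr2; have := sqr_ge0 t; lra. Qed.

Section pathwise.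
Context {R : realType} {n : nat} (X : set 'rV[R]_n) (F : 'rV[R]_n -> 'rV[R]_n).
Hypotheses (X0 : X !=set0) (Xcl : closed X) (Xconv : convex_set X).
Variables (L B : R).
Hypotheses
  (FL : forall x y, X x -> X y -> enorm (F x - F y) <= L * enorm (x - y))
  (FB : forall x, X x -> enorm (F x) <= B / 2).

Lemma edotDD_le_bound (u w : 'rV[R]_n) : edot u u <= (B / 2) ^+ 2 ->
  edot (u + w) (u + w) <= 2 * ((B / 2) ^+ 2 + edot w w).
Proof.
by move=> uB; apply: le_trans (edotDD_le u w) _; rewrite ler_wpM2l// lerD2r.
Qed.

(** The basic inequality for one move. The trial point [y] is only used through
    [|F y - F x| <= L g |F x + w|]: its contribution is of order [g ^+ 2], like
    the square of the step. *)
Lemma extragradient_step (g : R) (x xs w w' : 'rV[R]_n) :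
  let y := eproj X (x - g *: (F x + w)) in
  let x' := eproj X (x - g *: (F y + w')) in
  X x -> X xs -> 0 <= g ->
  edot (x' - xs) (x' - xs) <= edot (x - xs) (x - xs)
    - g * (2 * edot (x - xs) (F x))
    + (g ^+ 2 * edot (x - xs) (x - xs)
       + 2 * (1 + L ^+ 2) * (g ^+ 2 * ((B / 2) ^+ 2 + (edot w w + edot w' w')))
       - 2 * (g * edot (x - xs) w')).
Proof.
move=> y x' Xx Xxs g0.
have Xy : X y by exact: eproj_in.
have FB2 z : X z -> edot (F z) (F z) <= (B / 2) ^+ 2.
  move=> Xz; rewrite -sqr_enorm ler_sqr ?nnegrE ?sqrtr_ge0//.
    exact: FB.
  exact: le_trans (sqrtr_ge0 _) (FB _ Xz).
have vv := edotDD_le_bound (F y) w' (FB2 _ Xy).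
have uu := edotDD_le_bound (F x) w (FB2 _ Xx).
have pp : edot (F y - F x) (F y - F x) <=
    L ^+ 2 * (g ^+ 2 * edot (F x + w) (F x + w)).
  have FLyx := FL _ _ Xy Xx.
  apply: (@le_trans _ _ (L ^+ 2 * edot (y - x) (y - x))).
    rewrite -!sqr_enorm -exprMn ler_sqr ?nnegrE ?sqrtr_ge0//.
    exact: le_trans (sqrtr_ge0 _) FLyx.
  rewrite ler_wpM2l ?sqr_ge0//.
  have := eproj_nonexpansive X X0 Xcl Xconv (x - g *: (F x + w)) x.
  rewrite (eproj_id X X0 Xcl Xconv x Xx) -/y addrAC subrr add0r edotNN.
  by rewrite edotZl edotZr mulrA.
have := eproj_nonexpansive X X0 Xcl Xconv (x - g *: (F y + w')) xs.
rewrite (eproj_id X X0 Xcl Xconv xs Xxs) -/x' addrAC edotBZ.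
have := edot_le_half (g *: (x - xs)) (- (F y - F x)).
rewrite edotNN edotNr !edotZl edotZr [edot (x - xs) (F y - F x)]edotBr.
rewrite [edot (x - xs) (F y + w')]edotDr.
have Lg0 : 0 <= L ^+ 2 * g ^+ 2 by rewrite mulr_ge0 ?sqr_ge0.
have {}pp := le_trans pp (ler_wpM2l (sqr_ge0 L) (ler_wpM2l (sqr_ge0 g) uu)).
have {}vv := ler_wpM2l (sqr_ge0 g) vv.
have r1 := mulr_ge0 Lg0 (edot_ge0 w').
have r2 := mulr_ge0 (sqr_ge0 g) (edot_ge0 w).
move: (edot (x' - xs) _) (edot (F y - F x) _) (edot (F y + w') _) pp vv.
move: (edot (x - xs) (x - xs)) (edot (x - xs) (F y)) (edot (x - xs) (F x)).
move: (edot (x - xs) w') ((B / 2) ^+ 2) (edot w w) (edot w' w') r1 r2.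
by move=> *; lra.
Qed.

(** One trajectory of the scheme: iterates [x], trial points [y], and errors [w]
    and [w'] of the two samples of each iteration. *)
Section run.
Variables (gamma : nat -> R) (x y w w' : nat -> 'rV[R]_n).
Hypotheses (g0 : forall k, 0 < gamma k)
  (g2 : cvgn (series (fun k => gamma k ^+ 2)))
  (gd : ~ cvgn (series gamma))
  (Xx0 : X (x 0%N))
  (yE : forall k, y k = eproj X (x k - gamma k *: (F (x k) + w k)))
  (xE : forall k, x k.+1 = eproj X (x k - gamma k *: (F (y k) + w' k)))
  (noise2 : cvgn (series (fun k => gamma k ^+ 2 *
     (edot (w k) (w k) + edot (w' k) (w' k))))).

(** Convergence of the noise series weighted by a function [phi] of the current
    iterate: coordinate by coordinate, the series of the
    [gamma k * phi (x k) * w' k] converges. *)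
Definition noise_cvg (phi : 'rV[R]_n -> 'rV[R]_n) : Prop :=
  forall i, cvgn (series (fun k => gamma k * phi (x k) 0 i * w' k 0 i)).

Lemma noise_cvg_edot phi : noise_cvg phi ->
  cvgn (series (fun k => gamma k * edot (phi (x k)) (w' k))).
Proof.
move=> phic.
have -> : (fun k => gamma k * edot (phi (x k)) (w' k)) =
    fun k => \sum_(i < n) gamma k * phi (x k) 0 i * w' k 0 i.
  apply/funext => k.
  by rewrite /edot mulr_sumr; apply: eq_bigr => i _; rewrite mulrA.
exact: is_cvg_series_sum.
Qed.

Lemma run_in k : X (x k).
Proof. by case: k => // k; rewrite xE; exact: eproj_in. Qed.

Let c k := 2 * (1 + L ^+ 2) *
  (gamma k ^+ 2 * ((B / 2) ^+ 2 + (edot (w k) (w k) + edot (w' k) (w' k)))).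

Let c_ge0 k : 0 <= c k.
Proof.
apply: mulr_ge0; first by rewrite mulr_ge0// addr_ge0 ?sqr_ge0.
by rewrite mulr_ge0 ?sqr_ge0// !addr_ge0 ?sqr_ge0 ?edot_ge0.
Qed.

Let c_cvg : cvgn (series c).
Proof.
have -> : c = (2 * (1 + L ^+ 2)) *: ((B / 2) ^+ 2 *: (fun k => gamma k ^+ 2) +
    (fun k => gamma k ^+ 2 * (edot (w k) (w k) + edot (w' k) (w' k)))).
  apply/funext => k; rewrite /c [gamma k ^+ 2 * (_ + _)]mulrDr.
  rewrite [gamma k ^+ 2 * (B / 2) ^+ 2]mulrC.
  by [].
by apply: is_cvg_seriesZ; apply: is_cvg_seriesD => //; exact: is_cvg_seriesZ.
Qed.

Let step xs k : X xs ->
  edot (x k.+1 - xs) (x k.+1 - xs) <= edot (x k - xs) (x k - xs)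
    - gamma k * (2 * edot (x k - xs) (F (x k)))
    + (gamma k ^+ 2 * edot (x k - xs) (x k - xs) + c k
       - 2 * (gamma k * edot (x k - xs) (w' k))).
Proof.
move=> Xxs; rewrite /c xE yE.
by apply: extragradient_step => //; [exact: run_in|exact: ltW].
Qed.

Section acute.
Variable xs : 'rV[R]_n.
Hypotheses (Xxs : X xs) (obtuse : forall u, X u -> 0 <= edot (u - xs) (F u)).

(** With [a k] the squared distance to [xs], the basic inequality gives
    [1 + a k.+1 <= (1 + a k) * (1 + u k)], where the noise enters [u k] through
    the bounded weight [damped xs (x k)]. *)
Lemma run_bounded : noise_cvg (damped xs) ->
  exists M, forall k, edot (x k - xs) (x k - xs) <= M.
Proof.
move=> /noise_cvg_edot dc.
pose u k := gamma k ^+ 2 + c k -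
  2 * (gamma k * edot (damped xs (x k)) (w' k)).
apply: (multiplicative_bounded _ u) => [k|k|].
- exact: edot_ge0.
- have := step xs k Xxs.
  have := mulr_ge0 (ltW (g0 k)) (obtuse _ (run_in k)).
  rewrite /u /damped edotZl.
  have a0 : 0 <= edot (x k - xs) (x k - xs) by exact: edot_ge0.
  have ac := mulr_ge0 a0 (c_ge0 k).
  have g2k := sqr_ge0 (gamma k).
  move: (edot (x k.+1 - xs) _) (edot _ (F _)) (edot _ (w' k)) => a' b e.
  move: (edot _ _) a0 ac => a a0 ac b0 aS.
  have a1 : 1 + a != 0 by rewrite gt_eqF// ltr_pwDl.
  have -> : (1 + a) *
      (1 + (gamma k ^+ 2 + c k - 2 * (gamma k * ((1 + a)^-1 * e)))) =
      (1 + a) * (1 + (gamma k ^+ 2 + c k)) - 2 * (gamma k * e) by field.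
  lra.
have -> : u = (fun k => gamma k ^+ 2) + c -
    2 *: (fun k => gamma k * edot (damped xs (x k)) (w' k)).
  by apply/funext.
apply: is_cvg_seriesB; first exact: is_cvg_seriesD.
exact: is_cvg_seriesZ.
Qed.

(** On a bounded trajectory the basic inequality is additive: if the noise series
    converges, the iterates are quasi-Fejer monotone with respect to [xs]. *)
Lemma run_quasi_fejer M : (forall k, edot (x k - xs) (x k - xs) <= M) ->
  cvgn (series (fun k => gamma k * edot (x k - xs) (w' k))) ->
  cvgn (fun k => edot (x k - xs) (x k - xs)) /\
  cvgn (series (fun k => gamma k * edot (x k - xs) (F (x k)))).
Proof.
move=> aM nc; pose a k := edot (x k - xs) (x k - xs).
pose u k := gamma k ^+ 2 * a k + c k - 2 * (gamma k * edot (x k - xs) (w' k)).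
have [||||ac bc] := almost_decreasing_cvg a
    (fun k => gamma k * (2 * edot (x k - xs) (F (x k)))) u.
- by move=> k; exact: edot_ge0.
- by move=> k; rewrite !mulr_ge0 ?(ltW (g0 k))// obtuse//; exact: run_in.
- by move=> k; exact: step.
- have -> : u = (fun k => gamma k ^+ 2 * a k) + c -
      2 *: (fun k => gamma k * edot (x k - xs) (w' k)) by apply/funext.
  apply: is_cvg_seriesB; last exact: is_cvg_seriesZ.
  apply: is_cvg_seriesD => //.
  apply: (@series_le_cvg _ _ (M *: (fun k => gamma k ^+ 2))).
  + by move=> k; rewrite mulr_ge0 ?sqr_ge0 ?edot_ge0.
  + by move=> k; rewrite mulr_ge0 ?sqr_ge0// (le_trans (edot_ge0 _) (aM 0%N)).
  + by move=> k; rewrite mulrC ler_wpM2r ?sqr_ge0 ?aM.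
  exact: is_cvg_seriesZ.
split=> //.
have -> : (fun k => gamma k * edot (x k - xs) (F (x k))) =
    2^-1 *: (fun k => gamma k * (2 * edot (x k - xs) (F (x k)))).
  by apply/funext => k; rewrite -[RHS]/(_^-1 * (_ * (2 * _))) mulrCA mulKf.
exact: is_cvg_seriesZ.
Qed.

End acute.

Section limit.
Hypotheses (Fc : {within X, continuous F}) (acute : acute_angle X F).
Hypotheses (w1 : noise_cvg (fun=> const_mx 1))
  (wx : forall N : nat, noise_cvg (clamp N%:R)).

Let noise_cvg_cst z : noise_cvg (fun=> z).
Proof.
move=> i; have -> : (fun k => gamma k * z 0 i * w' k 0 i) =
    z 0 i *: (fun k => gamma k * (const_mx 1 : 'rV[R]_n) 0 i * w' k 0 i).
  apply/funext => k; rewrite -[RHS]/(_ * (_ * _ * _)) mxE mulr1.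
  by rewrite mulrA [z 0 i * _]mulrC.
apply: is_cvg_seriesZ; exact: w1.
Qed.

(* on a bounded trajectory a large enough truncation is inactive *)
Let bounded_noise_cvg K z : (forall k, edot (x k) (x k) <= K) ->
  cvgn (series (fun k => gamma k * edot (x k - z) (w' k))).
Proof.
move=> xK; have K0 : 0 <= K by exact: le_trans (edot_ge0 _) (xK 0%N).
pose N := Num.bound (1 + K).
have xN k i : `|x k 0 i| <= N%:R.
  have := archi_boundP (addr_ge0 ler01 K0) => ltN; apply: le_trans (ltW ltN).
  apply: le1D_of_sqr_le; rewrite -normrX ger0_norm ?sqr_ge0//.
  exact: le_trans (sqr_coord_le_edot _ _) (xK k).
have clampx k : clamp N%:R (x k) = x k.
  apply/rowP => i; rewrite mxE.
  have := xN k i; rewrite ler_norml => /andP[lo hi].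
  by rewrite (min_idPr hi) (max_idPr lo).
have -> : (fun k => gamma k * edot (x k - z) (w' k)) =
    (fun k => gamma k * edot (clamp N%:R (x k)) (w' k)) -
    (fun k => gamma k * edot z (w' k)).
  apply/funext => k; rewrite -[RHS]/(_ * edot _ _ - _ * edot _ _).
  by rewrite clampx edotBl mulrBr.
apply: is_cvg_seriesB; first exact: noise_cvg_edot (wx N).
exact: noise_cvg_edot (noise_cvg_cst z).
Qed.

(** Along a convergent subsequence [edot (x k - xs) (F (x k))] tends to [0]; the
    limit of the subsequence is a solution by the acute angle relation, and
    since the distance from [x k] to any solution converges, the whole sequence
    tends to it. *)
Lemma run_limit xs : svi_sol X F xs -> noise_cvg (damped xs) ->
  exists2 z, svi_sol X F z & x @ \oo --> z.
Proof.
move=> xsol dc; have [Xxs _] := xsol.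
have ge0 z : svi_sol X F z -> forall u, X u -> 0 <= edot (u - z) (F u).
  by move=> zsol u Xu; exact: (acute_angle_ge0 X F).
have [M aM] := run_bounded xs Xxs (ge0 _ xsol) dc.
pose K := 2 * (M + edot xs xs).
have xK k : edot (x k) (x k) <= K.
  rewrite -{1 2}(subrK xs (x k)); apply: le_trans (edotDD_le _ _) _.
  by rewrite ler_wpM2l// lerD2r.
have fejer z : svi_sol X F z ->
    cvgn (fun k => edot (x k - z) (x k - z)) /\
    cvgn (series (fun k => gamma k * edot (x k - z) (F (x k)))).
  move=> zsol; have [Xz _] := zsol.
  apply: (run_quasi_fejer z Xz (ge0 _ zsol) (2 * (K + edot z z))).
    move=> k; apply: le_trans (edotDD_le (x k) (- z)) _.
    by rewrite edotNN ler_wpM2l// lerD2r.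
  exact: (bounded_noise_cvg K).
have [_ bc] := fejer _ xsol.
pose b k := edot (x k - xs) (F (x k)).
have b0 k : 0 <= b k by apply: ge0 => //; exact: run_in.
have small (j : nat) : exists k, (j <= k)%N /\ b k < j.+1%:R^-1.
  have [|k jk bk] := frequently_small gamma b (fun k => ltW (g0 k)) b0 gd bc
    j.+1%:R^-1 j; first by rewrite invr_gt0.
  by exists k.
(* [z] is a cluster point of a subsequence along which [b] tends to [0] *)
have [s sP] := choice small.
have [|||z [_ zcl]] := @bounded_closed_compact R n [set u | edot u u <= K] _ _
    ((x \o s) @ \oo) _.
- exists (1 + K); split; first exact: num_real.
  move=> r ltr u /= uK; apply: le_trans (ltW ltr); apply: le1D_of_sqr_le.
  exact: le_trans (sqr_norm_le_edot u) uK.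
- have -> : [set u : 'rV[R]_n | edot u u <= K] =
      (fun u => edot (u - 0) (u - 0)) @^-1` [set t | t <= K].
    by apply/seteqP; split => u /=; rewrite subr0.
  apply: closed_comp => [u _|]; last exact: closed_le.
  exact: continuous_sqdist.
- by exists 0%N => // j _; exact: xK.
have close (j : nat) : exists k, [/\ (j <= k)%N, b k < j.+1%:R^-1 &
    `|z - x k| < j.+1%:R^-1].
  have [||u [[m /= jm <-] zu]] := zcl ((x \o s) @` [set m | (j <= m)%N])
      (ball z j.+1%:R^-1).
  - by exists j => // m /= jm; exists m.
  - by apply: nbhsx_ballx; rewrite invr_gt0.
  have [sm bsm] := sP m; exists (s m); split.
  - exact: leq_trans sm.
  - apply: lt_le_trans bsm _; rewrite lef_pV2 ?posrE// ler_nat ltnS//.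
  - by move: zu; rewrite -ball_normE.
(* a further subsequence, again called [s], converges to [z] *)
have {zcl small sP s} [s sP] := choice close.
have inv_small (f : nat -> R) : (forall j, 0 <= f j <= j.+1%:R^-1) ->
    f @ \oo --> (0 : R).
  move=> fP; apply: squeeze_cvgr (cvg_cst (0 : R)) (@cvg_harmonic R).
  exact: nearW.
have xsz : (x \o s) @ \oo --> z.
  apply/cvgrPdist_lt => e e0.
  have : (fun j => `|z - x (s j)|) @ \oo --> (0 : R).
    by apply: inv_small => j; have [_ _ /ltW->] := sP j; rewrite normr_ge0.
  by move=> /cvgr_lt/(_ _ e0).
have Xz : X z.
  apply: (@closed_cvg _ _ _ _ (x \o s) X Xcl _ z xsz).
  by apply: nearW => j; exact: run_in.
have Fsz := within_continuous_cvg X F Fc _ _ Xz (fun j => run_in (s j)) xsz.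
have bz : (b \o s) @ \oo --> edot (z - xs) (F z).
  by apply: cvg_edot => //; apply: cvgB => //; exact: cvg_cst.
have bs0 : (b \o s) @ \oo --> (0 : R).
  by apply: inv_small => j; have [_ /ltW-> _] := sP j; rewrite b0.
have zsol : svi_sol X F z.
  apply: contrapT => znsol; have := acute _ _ Xz znsol xsol.
  by rewrite (cvg_unique _ bz bs0) ?ltxx.
exists z => //; have [/cvg_ex[l al] _] := fejer _ zsol.
have soo : s @ \oo --> \oo.
  move=> A [N _ NA]; exists N => // j /= Nj; apply: NA => /=.
  by have [js _ _] := sP j; exact: leq_trans js.
have asl : (fun j => edot (x (s j) - z) (x (s j) - z)) @ \oo --> l.
  exact: (cvg_comp _ _ soo al).
have as0 : (fun j => edot (x (s j) - z) (x (s j) - z)) @ \oo -->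
    edot (z - z) (z - z) by exact: (@cvg_sqdist R n _ \oo _ (x \o s) z z xsz).
apply: edot_cvg0; suff <- : l = 0 by [].
by rewrite -(@edot0 R n) -[in RHS](subrr z); exact: (cvg_unique _ asl as0).
Qed.

End limit.

End run.

End pathwise.

(** * Borel measurability of vector-valued maps *)

Section borel_vectors.
Context {R : realType} {n : nat}.

Lemma open_borel (A : set 'rV[R]_n) :
  open A -> measurable (A : set (borelV R n)).
Proof. exact: sub_sigma_algebra. Qed.

Lemma closed_borel (A : set 'rV[R]_n) :
  closed A -> measurable (A : set (borelV R n)).
Proof.
by move=> clA; rewrite -[A]setCK; apply: measurableC; apply: open_borel;
  exact: closed_openC.
Qed.

Lemma continuous_borel_real (f : 'rV[R]_n -> R) :
  continuous f -> measurable_fun setT (f : borelV R n -> R).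
Proof.
move=> cf; apply: (measurability _ (RGenOInfty.measurableE R)) => //.
move=> _ [_ [a ->] <-]; rewrite setTI; apply: open_borel.
by apply: open_comp => [x _|]; [exact: cf|exact: interval_open].
Qed.

Lemma continuous_borel {m : nat} (f : 'rV[R]_n -> 'rV[R]_m) :
  continuous f -> measurable_fun setT (f : borelV R n -> borelV R m).
Proof.
move=> cf.
apply: (@measurability _ _ _ (borelV R m) _ _ (@open 'rV[R]_m)) => //.
move=> _ [A oA <-]; rewrite setTI; apply: open_borel.
by apply: open_comp => // x _; exact: cf.
Qed.

Lemma measurable_coord (i : 'I_n) :
  measurable_fun setT (fun u : borelV R n => (u : 'rV[R]_n) 0 i).
Proof. by apply: continuous_borel_real; exact: coord_continuous. Qed.

(** The cube of center [p.1] and half-width [1 / (p.2 + 1)]. *)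
Definition rat_box (p : 'rV[rat]_n * nat) : set 'rV[R]_n :=
  ball (map_mx ratr p.1 : 'rV[R]_n) p.2.+1%:R^-1.

Lemma open_bigcup_rat_box (U : set 'rV[R]_n) : open U ->
  U = \bigcup_p (if `[< rat_box p `<=` U >] then rat_box p else set0).
Proof.
move=> oU; apply/seteqP; split => [x Ux|x [p _]]; last first.
  by case: asboolP => // sub; exact: sub.
have /nbhs_ballP[e /= e0 eU] : nbhs x U by exact: open_nbhs_nbhs.
have [N ltN] : exists N : nat, N.+1%:R^-1 < e / 2.
  exists (Num.truncn (e / 2)^-1).
  by rewrite invf_plt ?posrE ?divr_gt0// truncnS_gt.
have r0 : 0 < N.+1%:R^-1 :> R by rewrite invr_gt0.
have exq i : exists q : rat, `|x 0 i - ratr q| < N.+1%:R^-1.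
  have [|q] := @rat_in_itvoo R (x 0 i - N.+1%:R^-1) (x 0 i + N.+1%:R^-1).
    by rewrite ltrBlDr -addrA ltrDl addr_gt0.
  rewrite in_itv/= => /andP[q1 q2]; exists q.
  by rewrite ltr_distl ltrBlDr q2 -ltrBlDr.
have [q qP] := choice exq.
have xq : ball (map_mx ratr (\row_i q i) : 'rV[R]_n) N.+1%:R^-1 x.
  split=> // i j; rewrite ord1 !mxE /ball/= distrC; exact: qP.
exists (\row_i q i, N) => //=; rewrite asboolT// => y qy.
apply: eU; rewrite [e]splitr; apply: ball_triangle (ball_sym _) _.
  by apply: le_ball xq; exact: ltW.
by apply: le_ball qy; exact: ltW.
Qed.

(** A vector-valued map is Borel measurable as soon as its coordinates are:
    every open set is a countable union of rational cubes. *)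
Lemma measurable_coordP {d : measure_display} {T : measurableType d}
    (f : T -> borelV R n) :
  (forall i, measurable_fun setT (fun t => (f t : 'rV[R]_n) 0 i)) ->
  measurable_fun setT f.
Proof.
move=> mf.
apply: (@measurability _ _ _ (borelV R n) _ _ (@open 'rV[R]_n)) => //.
move=> _ [U oU <-]; rewrite setTI (open_bigcup_rat_box U oU) preimage_bigcup.
apply: countable_bigcupT_measurable => // -[q N] /=.
case: asboolP => _; last by rewrite preimage_set0.
have -> : f @^-1` rat_box (q, N) =
    \bigcap_(i in [set: 'I_n]) ((fun t => (f t : 'rV[R]_n) 0 i) @^-1`
        ball (ratr (q 0 i) : R) N.+1%:R^-1).
  apply/seteqP; split => [t [_ h] i _|t h].
    by have := h 0 i; rewrite mxE.
  split; first by rewrite invr_gt0.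
  by move=> i j; rewrite ord1 mxE; exact: h.
apply: fin_bigcap_measurable => [|i _]; first exact: finite_finset.
by rewrite -[X in measurable X]setTI; apply: mf => //; exact: measurable_ball.
Qed.

End borel_vectors.

(** * Measurability of one move of the scheme *)

Lemma measurable_fun_g_sigma_sub {T : pointedType} {d : measure_display}
    {U : measurableType d} (G G' : set (set T)) (f : T -> U) :
  <<s G >> `<=` <<s G' >> ->
  measurable_fun setT (f : g_sigma_algebraType G -> U) ->
  measurable_fun setT (f : g_sigma_algebraType G' -> U).
Proof. by move=> GG' mf _ Y mY; apply: GG'; exact: mf. Qed.

Lemma measurable_fun_g_sigma_measurable {d' : measure_display}
    {T : measurableType d'} {d : measure_display}
    {U : measurableType d} (G : set (set T)) (f : T -> U) :
  <<s G >> `<=` measurable ->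
  measurable_fun setT (f : g_sigma_algebraType G -> U) ->
  measurable_fun setT f.
Proof. by move=> GT mf _ Y mY; apply: GT; exact: mf. Qed.

Lemma g_sigma_mono {T : Type} (G G' : set (set T)) :
  G `<=` <<s G' >> -> <<s G >> `<=` <<s G' >>.
Proof.
move=> GG'; apply: smallest_sub => //; exact: smallest_sigma_algebra.
Qed.

Section move.
Context {R : realType} {n d : nat} {dO : measure_display}
  {Om : measurableType dO} (P : probability Om R) (xi : Om -> 'rV[R]_d)
  (X : set 'rV[R]_n) (F : 'rV[R]_n -> 'rV[R]_d -> 'rV[R]_n).
Variable gamma : nat -> R.
Let G := fun x w => F x (xi w).
Let Fm := mean_map P G.
Hypotheses (X0 : X !=set0) (Xcl : closed X) (Xconv : convex_set X)
  (mxi : measurable_fun setT (xi : Om -> borelV R d))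
  (mF : @measurable_fun _ _ (borelV R n * borelV R d)%type (borelV R n)
    (X `*` setT) (fun p => F p.1 p.2))
  (Fc : {within X, continuous Fm}).

(** The mean cancels: a move only evaluates the random map at the sample. *)
Lemma esa_moveE k x z w :
  esa_move P X G gamma k x z w = eproj X (x - gamma k *: G z w).
Proof. by rewrite /esa_move /sample_error [_ + (G z w - _)]addrC subrK. Qed.

(** The mean map is only known to be continuous on [X]; precomposed with the
    projection it is continuous everywhere, hence Borel measurable. *)
Lemma continuous_eproj_mean : continuous (fun u => Fm (eproj X u)).
Proof.
move=> u; have /subspace_continuousP/(_ _ (eproj_in X X0 Xcl u)) Fu := Fc.
have pu : eproj X @ u --> within X (nbhs (eproj X u)).
  move=> A /= wA.
  have : \forall v \near u, X (eproj X v) -> A (eproj X v).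
    exact: (eproj_continuous X X0 Xcl Xconv u _ wA).
  by apply: filterS => v; apply; exact: eproj_in.
exact: cvg_comp pu Fu.
Qed.

Context {d' : measure_display} {T : measurableType d'}.
Variables (x z : T -> 'rV[R]_n) (w : T -> Om).
Hypotheses (mx : measurable_fun setT (x : T -> borelV R n))
  (mz : measurable_fun setT (z : T -> borelV R n))
  (mw : measurable_fun setT w) (Xz : forall t, X (z t)).

Lemma measurable_sample :
  measurable_fun setT ((fun t => G (z t) (w t)) : T -> borelV R n).
Proof.
apply: (@measurable_comp _ _ _ _ (borelV R n * borelV R d)%type (borelV R n)
  (X `*` setT) (fun p => F p.1 p.2) setT
  (fun t => (z t, xi (w t)) : borelV R n * borelV R d)) => //.
- by apply: measurableX => //; exact: closed_borel.
- by move=> _ [t _ <-]; split => /=.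
- by apply: measurable_fun_pair => //; exact: measurableT_comp.
Qed.

Lemma measurable_esa_move k :
  measurable_fun setT ((fun t => esa_move P X G gamma k (x t) (z t) (w t)) :
    T -> borelV R n).
Proof.
rewrite (_ : (fun t => _) =
  eproj X \o (fun t => x t - gamma k *: G (z t) (w t))).
  apply: (@measurableT_comp _ _ _ _ (borelV R n) (borelV R n)).
    by apply: continuous_borel; exact: eproj_continuous.
  apply: measurable_coordP => i.
  rewrite (_ : (fun t => _) =
      (fun t => x t 0 i - gamma k * G (z t) (w t) 0 i)); last first.
    by apply/funext => t; rewrite !mxE.
  apply: measurable_funB.
    exact: measurableT_comp (measurable_coord i) mx.
  apply: measurable_funM; first exact: measurable_cst.
  exact: measurableT_comp (measurable_coord i) measurable_sample.
by apply/funext => t; rewrite esa_moveE.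
Qed.

Lemma measurable_sample_error i :
  measurable_fun setT (fun t => sample_error P G (z t) (w t) 0 i).
Proof.
rewrite (_ : (fun t => _) =
    (fun t => G (z t) (w t) 0 i - Fm (eproj X (z t)) 0 i)); last first.
  by apply/funext => t; rewrite (eproj_id X X0 Xcl Xconv) // !mxE.
apply: measurable_funB.
  exact: measurableT_comp (measurable_coord i) measurable_sample.
have mFp := continuous_borel _ continuous_eproj_mean.
exact: measurableT_comp (measurable_coord i) (measurableT_comp mFp mz).
Qed.

End move.

(** * The histories of the run *)

Section histories.
Context {R : realType} {n : nat} {dO : measure_display}
  {Om : measurableType dO} {dT : measure_display} {T : measurableType dT}.
Variables (x0 : T -> 'rV[R]_n) (om omh : nat -> T -> Om).
Local Notation H_ := (history x0 om omh).
Local Notation Hh_ := (history_half x0 om omh).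

(** The family that generates [history k], which is convertible to
    [<<s history_gen k >>]. The measurable space it defines on [T] is
    [g_sigma_algebraType (history_gen k)]. *)
Definition history_gen (k : nat) : set (set T) :=
  preimage_set_system setT (x0 : T -> borelV R n) measurable `|`
  \bigcup_(j < k) (preimage_set_system setT (om j) measurable `|`
                   preimage_set_system setT (omh j) measurable).

(** The same for [history_half k]. *)
Definition history_half_gen (k : nat) : set (set T) :=
  H_ k `|` preimage_set_system setT (om k) measurable.

Lemma history_sub_half k : H_ k `<=` Hh_ k.
Proof. by move=> A HA; apply: sub_sigma_algebra; left. Qed.

Lemma history_half_sub k : Hh_ k `<=` H_ k.+1.
Proof.
apply: g_sigma_mono => A [|HA]; last first.
  by apply: sub_sigma_algebra; right; exists k => //=; left.
apply: g_sigma_mono => {}A [HA|[j /= jk HA]]; apply: sub_sigma_algebra.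
  by left.
by right; exists j => //=; exact: ltnW.
Qed.

Lemma history_sub_measurable k :
  measurable_fun setT (x0 : T -> borelV R n) ->
  (forall k, measurable_fun setT (om k)) ->
  (forall k, measurable_fun setT (omh k)) -> H_ k `<=` measurable.
Proof.
move=> mx0 mom momh; apply: smallest_sub; first exact: sigma_algebra_measurable.
by move=> _ [[B mB <-]|[j _ [[B mB <-]|[B mB <-]]]];
  [exact: mx0|exact: mom|exact: momh].
Qed.

Context {d : nat}.
Variables (P : probability Om R) (xi : Om -> 'rV[R]_d) (X : set 'rV[R]_n)
  (F : 'rV[R]_n -> 'rV[R]_d -> 'rV[R]_n) (gamma : nat -> R).
Let G := fun x w => F x (xi w).
Local Notation Fm := (mean_map P G).
Hypotheses (X0 : X !=set0) (Xcl : closed X) (Xconv : convex_set X)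
  (mxi : measurable_fun setT (xi : Om -> borelV R d))
  (mF : @measurable_fun _ _ (borelV R n * borelV R d)%type (borelV R n)
    (X `*` setT) (fun p => F p.1 p.2))
  (Fc : {within X, continuous Fm}) (Xx0 : forall t, X (x0 t)).
Local Notation x_ := (esa P X G gamma x0 om omh).
Local Notation xh_ := (esa_half P X G gamma x0 om omh).
Local Notation HT k := (g_sigma_algebraType (history_gen k)).
Local Notation HhT k := (g_sigma_algebraType (history_half_gen k)).

Lemma esa_in k t : X (x_ k t).
Proof. by case: k => //= k; exact: eproj_in. Qed.

Lemma esa_half_in k t : X (xh_ k t).
Proof. exact: eproj_in. Qed.

Lemma measurable_om k : measurable_fun setT (om k : HhT k -> Om).
Proof. by move=> _ B mB; apply: sub_sigma_algebra; right; exists B. Qed.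

Lemma measurable_omh k : measurable_fun setT (omh k : HT k.+1 -> Om).
Proof.
move=> _ B mB; apply: sub_sigma_algebra; right; exists k => //=.
by right; exists B.
Qed.

Lemma measurable_half_of_esa k :
  measurable_fun setT (x_ k : HT k -> borelV R n) ->
  measurable_fun setT (xh_ k : HhT k -> borelV R n).
Proof.
move=> mx; apply: (measurable_esa_move P xi X F gamma) => //.
- exact: measurable_fun_g_sigma_sub (history_sub_half k) mx.
- exact: measurable_fun_g_sigma_sub (history_sub_half k) mx.
- exact: measurable_om.
- exact: esa_in.
Qed.

Lemma measurable_esa k : measurable_fun setT (x_ k : HT k -> borelV R n).
Proof.
elim: k => [|k IH].
  by move=> _ B mB; apply: sub_sigma_algebra; left; exists B.
apply: (@measurable_esa_move _ _ _ _ _ P xi X F gamma X0 Xcl Xconv mxi mF _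
  (HT k.+1) (x_ k) (xh_ k) (omh k)) => //.
- apply: measurable_fun_g_sigma_sub IH.
  exact: subset_trans (history_sub_half k) (history_half_sub k).
- apply: measurable_fun_g_sigma_sub (measurable_half_of_esa k IH).
  exact: history_half_sub.
- exact: measurable_omh.
- exact: esa_half_in.
Qed.

Lemma measurable_esa_half k : measurable_fun setT (xh_ k : HhT k -> borelV R n).
Proof. exact: measurable_half_of_esa (measurable_esa k). Qed.

Lemma measurable_noise_half k i :
  measurable_fun setT
    ((fun t => esa_noise_half P X G gamma x0 om omh k t 0 i) : HT k.+1 -> R).
Proof.
apply: (measurable_sample_error P xi X F) => //.
- apply: measurable_fun_g_sigma_sub (measurable_esa_half k).
  exact: history_half_sub.
- exact: measurable_omh.
- exact: esa_half_in.
Qed.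

End histories.

(** * Integrals and conditionally centered functions *)

Section integrals.
Context {R : realType} {dT : measure_display} {T : measurableType dT}.
Variable Q : probability T R.
Implicit Types f w Z : T -> R.

Lemma integrable_bounded_mul Z w (C : R) : measurable_fun setT Z ->
  (forall t, `|Z t| <= C) -> Q.-integrable setT (EFin \o w) ->
  Q.-integrable setT (EFin \o (fun t => Z t * w t)).
Proof.
move=> mZ ZC iw.
rewrite (_ : _ \o _ = (EFin \o Z) \* (EFin \o w))%E; last first.
  by apply/funext => t /=; rewrite EFinM.
apply: integrableMr => //; exists C; split; first exact: num_real.
by move=> M ltM t _; exact: le_trans (ZC t) (ltW ltM).
Qed.

Lemma integrable_scale (k : R) w : Q.-integrable setT (EFin \o w) ->
  Q.-integrable setT (EFin \o (fun t => k * w t)).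
Proof. exact: (integrable_bounded_mul (cst k) w `|k|). Qed.

Lemma integrable_add f w : Q.-integrable setT (EFin \o f) ->
  Q.-integrable setT (EFin \o w) ->
  Q.-integrable setT (EFin \o (fun t => f t + w t)).
Proof.
move=> fi wi; rewrite (_ : _ \o _ = (EFin \o f) \+ (EFin \o w))%E.
  exact: integrableD.
by apply/funext => t /=; rewrite EFinD.
Qed.

(** Tonelli: nonnegative functions with summable integrals have, almost
    everywhere, a convergent series. *)
Lemma ae_series_cvg (f : nat -> T -> R) (s : nat -> R) :
  (forall k t, 0 <= f k t) -> (forall k, Q.-integrable setT (EFin \o f k)) ->
  (forall k, \int[Q]_t f k t <= s k) -> cvgn (series s) ->
  {ae Q, forall t, cvgn (series (f^~ t))}.
Proof.
move=> f0 fi fs sc.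
have If k : (\int[Q]_t (f k t)%:E = (\int[Q]_t f k t)%:E)%E.
  by rewrite /Rintegral fineK//; exact: (integrable_fin_num measurableT (fi k)).
have s0 k : 0 <= s k by apply: le_trans (fs k); apply: Rintegral_ge0.
pose g t := (\sum_(k <oo) (f k t)%:E)%E.
have mf k : measurable_fun setT (fun t => (f k t)%:E).
  exact: (measurable_int _ (fi k)).
have g_ge0 t : (0 <= g t)%E.
  by apply: nneseries_ge0 => k _ _; rewrite lee_fin.
have gi : Q.-integrable setT g.
  apply/integrableP; split.
    apply: ge0_emeasurable_sum => // k t _ _; rewrite lee_fin; exact: f0.
  under eq_integral do rewrite gee0_abs//.
  rewrite integral_nneseries//; last by move=> k t _; rewrite lee_fin.
  apply: (@le_lt_trans _ _ (\sum_(k <oo) (s k)%:E)%E).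
    apply: lee_nneseries => [k *|k *]; last by rewrite If lee_fin.
    by apply: integral_ge0 => t _; rewrite lee_fin.
  rewrite (_ : (fun n => _) = EFin \o series s); last first.
    by apply/funext => k; rewrite /= /series/= sumEFin.
  by rewrite EFin_lim// ltry.
apply: filterS (integrable_ae measurableT gi) => t /(_ I) gt.
apply: nnseries_is_cvg => //.
by move: gt; rewrite ge0_fin_numE.
Qed.

(** [w] has mean zero conditionally on the sigma-algebra generated by [g]; this
    is expressed with the integrals of [w] over the sets of this algebra. *)
Definition cond_mean0 (g : set (set T)) w : Prop :=
  Q.-integrable setT (EFin \o w) /\
  forall A, <<s g >> A -> \int[Q]_(t in A) w t = 0.

Section bounded_multiplier.
Variables (g : set (set T)) (w : T -> R).
Hypotheses (gT : <<s g >> `<=` measurable) (w0 : cond_mean0 g w).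

(* A function [Z] with values between 0 and 1 is half the sum of the indicator
   of [2^-1 <= Z], whose product with [w] has integral zero, and of another such
   function: each round gains a factor [2^-1] in the bound. *)
Let unit_mul m : forall Z,
  measurable_fun setT (Z : g_sigma_algebraType g -> R) ->
  (forall t, 0 <= Z t <= 1) ->
  `|\int[Q]_t (Z t * w t)| <= 2^-1 ^+ m * \int[Q]_t `|w t|.
Proof.
have [iw w0A] := w0.
have mT Z := measurable_fun_g_sigma_measurable g Z gT.
elim: m => [|m IH] Z mZ Z01.
  have Z1 t : `|Z t| <= 1.
    by have /andP[? ?] := Z01 t; rewrite ger0_norm.
  have iZw := integrable_bounded_mul _ _ _ (mT _ mZ) Z1 iw.
  rewrite expr0 mul1r; apply: le_trans (le_normr_Rintegral measurableT iZw) _.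
  apply: le_Rintegral => //; [exact: integrable_norm|exact: integrable_norm|].
  by move=> t _; rewrite normrM ler_piMl.
pose A := [set t | 2^-1 <= Z t].
have gA : <<s g >> A.
  rewrite (_ : A = setT `&` Z @^-1` `[2^-1, +oo[%classic).
    exact: mZ.
  by rewrite setTI; apply/seteqP; split => t; rewrite /A/= in_itv/= andbT.
pose b : T -> R := \1_A.
pose Z' t := 2 * Z t - b t.
have mb : measurable_fun setT (b : g_sigma_algebraType g -> R).
  exact: (@measurable_indic _ (g_sigma_algebraType g)).
have mZ' : measurable_fun setT (Z' : g_sigma_algebraType g -> R).
  by apply: measurable_funB => //; apply: measurable_funM.
have bE t : b t = (2^-1 <= Z t)%R%:R.
  rewrite /b indicE; congr (_%:R : R); congr nat_of_bool.
  by apply/idP/idP; rewrite inE.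
have b1 t : `|b t| <= 1.
  by rewrite bE; case: (_ <= Z t); rewrite /= ?normr1 ?normr0.
have Z'01 t : 0 <= Z' t <= 1.
  have /andP[Z0 Z1] := Z01 t; rewrite /Z' bE.
  by case: (leP 2^-1 (Z t)) => half /=; apply/andP; split; lra.
have Z'1 t : `|Z' t| <= 1.
  by have /andP[? ?] := Z'01 t; rewrite ger0_norm.
have ib := integrable_bounded_mul _ _ _ (mT _ mb) b1 iw.
have iZ' := integrable_bounded_mul _ _ _ (mT _ mZ') Z'1 iw.
have bw0 : \int[Q]_t (b t * w t) = 0.
  rewrite -[RHS](w0A A gA) [RHS]Rintegral_mkcond; apply: eq_Rintegral => t _.
  by rewrite patchE /b indicE; case: (t \in A); rewrite ?mul1r ?mul0r.
have -> : \int[Q]_t (Z t * w t) = 2^-1 * \int[Q]_t (Z' t * w t).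
  rewrite -RintegralZl//.
  rewrite -[RHS]add0r -[0 in RHS](mulr0 2^-1) -[0 in RHS]bw0 -RintegralZl//.
  rewrite -RintegralD//.
  - by apply: eq_Rintegral => t _; rewrite /Z'; lra.
  - exact: integrable_scale.
  - exact: integrable_scale.
rewrite normrM gtr0_norm ?invr_gt0// exprS -mulrA ler_wpM2l ?invr_ge0//.
exact: IH.
Qed.

(** A conditionally centered function is orthogonal to the bounded functions
    that are measurable for the conditioning sigma-algebra. *)
Lemma cond_mean0_mul Z C :
  measurable_fun setT (Z : g_sigma_algebraType g -> R) ->
  (forall t, `|Z t| <= C) -> \int[Q]_t (Z t * w t) = 0.
Proof.
move=> mZ ZC.
have [iw w0A] := w0.
have C0 : 0 <= C by exact: le_trans (normr_ge0 _) (ZC point).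
pose K := C + 1; have K0 : 0 < K by rewrite ltr_wpDl.
pose Z1 t := (2 * K)^-1 * (Z t + K).
have mZ1 : measurable_fun setT (Z1 : g_sigma_algebraType g -> R).
  by apply: measurable_funM => //; exact: measurable_funD.
have Z101 t : 0 <= Z1 t <= 1.
  have := ZC t; rewrite ler_norml => /andP[lo hi].
  rewrite /Z1 mulr_ge0 ?invr_ge0 ?mulr_ge0 ?(ltW K0)//=; last first.
    by rewrite /K; lra.
  by rewrite mulrC ler_pdivrMr ?mulr_gt0// mul1r /K; lra.
have Z1w0 : \int[Q]_t (Z1 t * w t) = 0.
  apply/eqP; rewrite -normr_eq0 eq_le normr_ge0 andbT.
  have lim : (fun m => 2^-1 ^+ m * \int[Q]_t `|w t|) @ \oo --> (0 : R).
    rewrite -[X in _ --> X](mul0r (\int[Q]_t `|w t|)).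
    apply: cvgM; last exact: cvg_cst.
    by apply: cvg_expr; rewrite gtr0_norm ?invr_gt0// invf_lt1// ltr1n.
  apply: (cvgr_to_ge lim); apply: nearW => m; exact: unit_mul.
have mT Z' := measurable_fun_g_sigma_measurable g Z' gT.
have Z11 t : `|Z1 t| <= 1 by have /andP[? ?] := Z101 t; rewrite ger0_norm.
have iZ1 := integrable_bounded_mul _ _ _ (mT _ mZ1) Z11 iw.
have wT : \int[Q]_t w t = 0.
  by apply: w0A; exact: (@measurableT _ (g_sigma_algebraType g)).
have -> : \int[Q]_t (Z t * w t) = \int[Q]_t ((2 * K) * (Z1 t * w t) - K * w t).
  apply: eq_Rintegral => t _; rewrite /Z1; field.
  by rewrite gt_eqF.
rewrite RintegralB//; [|exact: integrable_scale|exact: integrable_scale].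
by rewrite !RintegralZl// Z1w0 wT !mulr0 subrr.
Qed.

End bounded_multiplier.
End integrals.

(** * Martingales with summable second moments *)

Section martingale.
Context {R : realType} {dT : measure_display} {T : measurableType dT}.
Variable Q : probability T R.
Variables (g : nat -> set (set T)) (d : nat -> T -> R) (s : nat -> R).
Hypotheses (gT : forall k, <<s g k >> `<=` measurable)
  (gS : forall k, <<s g k >> `<=` <<s g k.+1 >>)
  (md : forall k, measurable_fun setT (d k : g_sigma_algebraType (g k.+1) -> R))
  (d0 : forall k, cond_mean0 Q (g k) (d k))
  (id2 : forall k, Q.-integrable setT (EFin \o (fun t => d k t ^+ 2)))
  (d2s : forall k, \int[Q]_t (d k t ^+ 2) <= s k)
  (sc : cvgn (series s)).

Let s0 k : 0 <= s k.
Proof.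
by apply: le_trans (d2s k); apply: Rintegral_ge0 => t _; exact: sqr_ge0.
Qed.

(** The sum of the [j] terms [d m], [d m.+1], ..., frozen at its first value of
    modulus at least [e]. *)
Fixpoint stopped_sum (m : nat) (e : R) (j : nat) (t : T) : R :=
  if j is i.+1 then
    let S := stopped_sum m e i t in
    if `|S| < e then S + d (m + i) t else S
  else 0.

(** The event that one of the first [j] partial sums from [m] on has modulus at
    least [e]. *)
Definition exit_set (m : nat) (e : R) (j : nat) : set T :=
  [set t | e <= `|stopped_sum m e j t|].

Section stopped.
Variables (m : nat) (e : R).
Hypothesis e0 : 0 < e.
Local Notation S := (stopped_sum m e).

Lemma measurable_stopped_sum j :
  measurable_fun setT (S j : g_sigma_algebraType (g (m + j)) -> R).
Proof.
elim: j => [|j IH]; first exact: measurable_cst.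
rewrite addnS /=.
have mS := measurable_fun_g_sigma_sub _ _ _ (gS (m + j)) IH.
apply: measurable_fun_ifT => //.
  apply: measurable_fun_ltr => //; exact: measurableT_comp.
exact: measurable_funD.
Qed.

Let mST j : measurable_fun setT (S j : T -> R).
Proof.
apply: measurable_fun_g_sigma_measurable (gT (m + j)) _.
exact: measurable_stopped_sum.
Qed.

Lemma stopped_sum_frozen i j t : (i <= j)%N -> e <= `|S i t| -> S j t = S i t.
Proof.
move=> ij eS; rewrite -(subnKC ij); elim: (j - i)%N => [|k IH].
  by rewrite addn0.
by rewrite addnS /= IH ltNge eS.
Qed.

Lemma stopped_sumE j t : `|S j t| < e -> S j t = \sum_(m <= k < m + j) d k t.
Proof.
elim: j => [|j IH] Sj; first by rewrite addn0 big_geq.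
rewrite /= in Sj *; case: ifPn Sj => [lt _|]; last by move=> /negbTE->.
by rewrite addnS big_nat_recr ?leq_addr//= IH.
Qed.

Lemma stopped_sum_exit i j t : (i <= j)%N ->
  e <= `|\sum_(m <= k < m + i) d k t| -> e <= `|S j t|.
Proof.
move=> ij eS; rewrite leNgt; apply/negP => Sj.
have [eSi|Si] := leP e `|S i t|.
  by move: Sj; rewrite (stopped_sum_frozen _ _ _ ij eSi) ltNge eSi.
by move: eS; rewrite -stopped_sumE// leNgt Si.
Qed.

(** The second moment of the stopped sums grows by at most [s k] at each step:
    the cross term vanishes, since the stopped sum that multiplies the new
    increment in it is bounded by [e]. *)
Lemma stopped_sum_sqr j :
  Q.-integrable setT (EFin \o (fun t => S j t ^+ 2)) /\
  \int[Q]_t (S j t ^+ 2) <= \sum_(m <= k < m + j) s k.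
Proof.
elim: j => [|j [iS IH]].
  rewrite addn0 big_geq//; split.
    rewrite (_ : _ \o _ = cst 0%E); first exact: integrable0.
    by apply/funext => t /=; rewrite expr0n.
  rewrite (_ : (fun t => _) = cst 0); last first.
    by apply/funext => t /=; rewrite expr0n.
  by rewrite Rintegral_cst// mul0r.
pose z t : R := if `|S j t| < e then 2 * S j t else 0.
pose c t : R := if `|S j t| < e then 1 else 0.
have mz : measurable_fun setT (z : g_sigma_algebraType (g (m + j)) -> R).
  have mS := measurable_stopped_sum j.
  apply: measurable_fun_ifT => //; last exact: measurable_funM.
  apply: measurable_fun_ltr => //; exact: measurableT_comp.
have mc : measurable_fun setT c.
  apply: measurable_fun_ifT => //.
  apply: measurable_fun_ltr => //; exact: measurableT_comp.
have zb t : `|z t| <= 2 * e.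
  rewrite /z; case: ifPn => [lt|_]; last by rewrite normr0 mulr_ge0// ltW.
  by rewrite normrM gtr0_norm// ler_pM2l// ltW.
have cb t : `|c t| <= 1 by rewrite /c; case: ifP; rewrite ?normr1 ?normr0.
have mzT := measurable_fun_g_sigma_measurable _ _ (gT (m + j)) mz.
have [id _] := d0 (m + j).
have iz := integrable_bounded_mul _ _ _ _ mzT zb id.
have ic := integrable_bounded_mul _ _ _ _ mc cb (id2 (m + j)).
have SE : (fun t => S j.+1 t ^+ 2) =
    (fun t => S j t ^+ 2 + (z t * d (m + j) t + c t * d (m + j) t ^+ 2)).
  by apply/funext => t; rewrite /z /c /=; case: ifP => _; ring.
have izc : Q.-integrable setT
    (EFin \o (fun t => z t * d (m + j) t + c t * d (m + j) t ^+ 2)).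
  exact: integrable_add iz ic.
rewrite SE; split; first exact: integrable_add iS izc.
have zd0 := cond_mean0_mul _ _ _ (gT (m + j)) (d0 (m + j)) _ _ mz zb.
rewrite RintegralD// RintegralD// zd0 add0r addnS.
rewrite big_nat_recr ?leq_addr//= lerD//.
apply: le_trans (d2s (m + j)); apply: le_Rintegral => // t _.
by rewrite /c; case: ifP => _; rewrite ?mul1r ?mul0r// sqr_ge0.
Qed.

Local Notation exit := (exit_set m e).

Lemma measurable_exit_set j : measurable (exit j).
Proof.
rewrite (_ : exit j = setT `&` (fun t => `|S j t|) @^-1` `[e, +oo[%classic).
  by apply: measurableT_comp => //; exact: measurableT.
by rewrite setTI; apply/seteqP; split => t; rewrite /exit_set/= in_itv/= andbT.
Qed.

(** Markov's inequality. *)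
Lemma prob_exit j :
  (Q (exit j) <= ((e ^+ 2)^-1 * \sum_(m <= k < m + j) s k)%:E)%E.
Proof.
have [iS Ss] := stopped_sum_sqr j.
have mexitj := measurable_exit_set j.
have ie : Q.-integrable setT (EFin \o (fun t => e ^+ 2 * \1_(exit j) t)).
  by apply: integrable_scale; exact: integrable_indic.
have Qfin : Q (exit j) \is a fin_num by exact: fin_num_measure.
rewrite -(fineK Qfin) lee_fin ler_pdivlMl ?exprn_gt0//.
apply: le_trans Ss.
have -> : e ^+ 2 * fine (Q (exit j)) = \int[Q]_t (e ^+ 2 * \1_(exit j) t).
  rewrite RintegralZl//; last exact: integrable_indic.
  by rewrite /Rintegral integral_indic// setIT.
apply: le_Rintegral => // t _; rewrite indicE.
have [/set_mem eS|_] := boolP (t \in exit j); last by rewrite mulr0 sqr_ge0.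
have : e ^+ 2 <= `|S j t| ^+ 2 by rewrite ler_sqr ?nnegrE ?(ltW e0).
by rewrite -normrX ger0_norm ?sqr_ge0//= mulr1.
Qed.

(** Kolmogorov's maximal inequality; the limit minus the partial sum is the tail
    of the series of the [s k]. *)
Lemma prob_maximal :
  (Q (\bigcup_j exit j) <= ((e ^+ 2)^-1 * (limn (series s) - series s m))%:E)%E.
Proof.
have ndE : nondecreasing_seq exit.
  move=> i j ij; apply/subsetPset => t /= eS.
  by rewrite /exit_set /= (stopped_sum_frozen _ _ _ ij eS).
have mE : measurable (\bigcup_j exit j) 
  by apply: bigcupT_measurable => j; exact: measurable_exit_set.
have lim := nondecreasing_cvg_mu (mu := Q) measurable_exit_set mE ndE.
apply: (cvge_to_le lim).
apply: nearW => j; apply: le_trans (prob_exit j) _.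
rewrite lee_fin ler_wpM2l ?invr_ge0 ?sqr_ge0//.
rewrite lerBrDl [(m + j)%N]addnC -series_addn.
apply: nondecreasing_cvgn_le => //.
by apply/nondecreasing_seqP => k; rewrite seriesS_eq lerDl.
Qed.

End stopped.

(** Almost sure convergence of a martingale whose increments have summable
    second moments. *)
Lemma martingale_cvg : {ae Q, forall t, cvgn (series (d^~ t))}.
Proof.
(* [N p m]: the partial sums from [m] on reach the modulus [1 / (p + 1)] *)
pose N (p m : nat) :=
  [set t | exists j, p.+1%:R^-1 <= `|\sum_(m <= k < m + j) d k t|].
suff : {ae Q, forall t, forall p, exists m, ~ N p m t}.
  apply: filterS => t small; apply: cauchy_cvg; apply/cauchy_seriesP => e e0.
  have [p pe] : exists p : nat, p.+1%:R^-1 < e / 2.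
    exists (Num.truncn (e / 2)^-1).
    by rewrite invf_plt ?posrE ?divr_gt0// truncnS_gt.
  have [m Nm] := small p.
  have bnd i : (m <= i)%N -> `|\sum_(m <= k < i) d k t| < e / 2.
    move=> mi; apply: lt_trans pe; rewrite ltNge; apply/negP => le.
    by apply: Nm; exists (i - m)%N; rewrite subnKC.
  exists ([set i | (m <= i)%N], [set i | (m <= i)%N]) => /=.
    by split; exists m.
  move=> [i1 i2] /= [mi1 mi2].
  have [le12|lt21] := leqP i1 i2; last by rewrite big_geq ?normr0// ltnW.
  have -> : \sum_(i1 <= k < i2) d k t =
      \sum_(m <= k < i2) d k t - \sum_(m <= k < i1) d k t.
    by rewrite (@big_cat_nat _ _ _ i1 m i2)//= addrAC subrr add0r.
  rewrite [e]splitr; apply: le_lt_trans (ler_normB _ _) _.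
  by rewrite ltrD ?bnd.
apply: ae_foralln => p.
pose e : R := p.+1%:R^-1; have e0 : 0 < e by rewrite invr_gt0.
pose E m := \bigcup_j exit_set m e j.
have mE m : measurable (E m).
  by apply: bigcupT_measurable => j; exact: measurable_exit_set.
exists (\bigcap_m E m); split.
- exact: bigcapT_measurable.
- apply/eqP; rewrite eq_le measure_ge0 andbT.
  have lim : ((e ^+ 2)^-1 * (limn (series s) - series s m))%:E @[m --> \oo]
      --> 0%E.
    apply: cvg_EFin; first exact: nearW.
    rewrite -[X in _ --> X](mulr0 (e ^+ 2)^-1).
    apply: cvgM; first exact: cvg_cst.
    rewrite -[X in _ --> X](subrr (limn (series s))).
    by apply: cvgB => //; exact: cvg_cst.
  apply: (cvge_to_ge lim).
  apply: nearW => m; apply: le_trans (prob_maximal m e e0).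
  apply: le_measure; rewrite ?inE.
  + exact: bigcapT_measurable.
  + exact: mE.
  + by move=> t; exact.
- move=> t /= bad m _.
  have [j ej] : N p m t by apply: contrapT => nN; apply: bad; exists m.
  by exists j => //=; exact: stopped_sum_exit ej.
Qed.

End martingale.

(** * The sampling noise *)

Section conditional_bounds.
Context {R : realType} {dT : measure_display} {T : measurableType dT}.
Variable Q : probability T R.
Variables (g : set (set T)).
Hypothesis gT : <<s g >> `<=` measurable.

Lemma cond_expectation_as_mean0 (w : T -> R) :
  cond_expectation_as Q <<s g >> w [set y | y = 0] -> cond_mean0 Q g w.
Proof.
move=> [Y [iw iY _ wY] Y0]; split=> // A gA.
rewrite /Rintegral wY// (ae_eq_integral (cst 0%E)).
- by rewrite integral0.
- exact: gT.
- exact: measurable_funS (measurable_int _ iY).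
- exact: measurable_cst.
- by apply: filterS Y0 => t /= -> _.
Qed.

Lemma cond_expectation_as_le (Z : T -> R) (c : R) :
  cond_expectation_as Q <<s g >> Z [set y | y <= c] ->
  Q.-integrable setT (EFin \o Z) /\ \int[Q]_t Z t <= c.
Proof.
move=> [Y [iZ iY _ ZY] Yc]; split=> //.
have gsetT : <<s g >> setT by exact: (@measurableT _ (g_sigma_algebraType g)).
have -> : \int[Q]_t Z t = \int[Q]_t Y t by rewrite /Rintegral ZY.
have ic : Q.-integrable setT (EFin \o cst c).
  exact: finite_measure_integrable_cst.
have -> : c = \int[Q]_t c.
  by rewrite Rintegral_cst//= probability_setT mulr1.
rewrite -subr_ge0 -RintegralB//.
have mcY : measurable_fun setT (fun t => c - Y t).
  apply: measurable_funB => //; apply/measurable_EFinP.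
  exact: measurable_int iY.
have -> : \int[Q]_t (c - Y t) = \int[Q]_t `|c - Y t|.
  congr fine; apply: ae_eq_integral => //.
  - exact/measurable_EFinP.
  - by apply/measurable_EFinP; exact: measurableT_comp.
  - by apply: filterS Yc => t /= Ytc _; rewrite ger0_norm// subr_ge0.
by apply: Rintegral_ge0.
Qed.

End conditional_bounds.

Section noise.
Context {R : realType} {n d : nat} {dO : measure_display}
  {Om : measurableType dO} {dT : measure_display} {T : measurableType dT}.
Variables (P : probability Om R) (xi : Om -> 'rV[R]_d) (X : set 'rV[R]_n)
  (F : 'rV[R]_n -> 'rV[R]_d -> 'rV[R]_n) (Q : probability T R)
  (x0 : T -> 'rV[R]_n) (om omh : nat -> T -> Om) (gamma : nat -> R) (nu : R).
Let G := fun x w => F x (xi w).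
Local Notation Fm := (mean_map P G).
Local Notation x_ := (esa P X G gamma x0 om omh).
Local Notation w_ := (esa_noise P X G gamma x0 om omh).
Local Notation wh_ := (esa_noise_half P X G gamma x0 om omh).
Local Notation H_ := (history x0 om omh).
Local Notation Hh_ := (history_half x0 om omh).
Hypotheses (X0 : X !=set0) (Xcl : closed X) (Xconv : convex_set X)
  (mxi : measurable_fun setT (xi : Om -> borelV R d))
  (mF : @measurable_fun _ _ (borelV R n * borelV R d)%type (borelV R n)
    (X `*` setT) (fun p => F p.1 p.2))
  (mx0 : measurable_fun setT (x0 : T -> borelV R n))
  (Xx0 : forall t, X (x0 t))
  (mom : forall k, measurable_fun setT (om k))
  (momh : forall k, measurable_fun setT (omh k))
  (Fc : {within X, continuous Fm})
  (wh0 : forall k i,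
    cond_expectation_as Q (Hh_ k) (fun t => wh_ k t 0 i) [set y | y = 0])
  (w2 : forall k, cond_expectation_as Q (H_ k) (fun t => enorm (w_ k t) ^+ 2)
       [set y | y <= nu ^+ 2])
  (wh2 : forall k, cond_expectation_as Q (Hh_ k)
       (fun t => enorm (wh_ k t) ^+ 2) [set y | y <= nu ^+ 2])
  (g2 : cvgn (series (fun k => gamma k ^+ 2))).

Let HT k : H_ k `<=` measurable.
Proof. exact: history_sub_measurable. Qed.

Let HhT k : <<s history_half_gen x0 om omh k >> `<=` measurable.
Proof. exact: subset_trans (history_half_sub x0 om omh k) (HT k.+1). Qed.

Let w2T k : Q.-integrable setT (EFin \o (fun t => edot (w_ k t) (w_ k t))) /\
  \int[Q]_t edot (w_ k t) (w_ k t) <= nu ^+ 2.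
Proof.
have := cond_expectation_as_le Q (history_gen x0 om omh k) _ _ (w2 k).
rewrite (_ : (fun t => enorm _ ^+ 2) = (fun t => edot (w_ k t) (w_ k t))).
  exact.
by apply/funext => t; rewrite sqr_enorm.
Qed.

Let wh2T k : Q.-integrable setT (EFin \o (fun t => edot (wh_ k t) (wh_ k t))) /\
  \int[Q]_t edot (wh_ k t) (wh_ k t) <= nu ^+ 2.
Proof.
have := cond_expectation_as_le Q (history_half_gen x0 om omh k) _ _ (wh2 k).
rewrite (_ : (fun t => enorm _ ^+ 2) = (fun t => edot (wh_ k t) (wh_ k t))).
  exact.
by apply/funext => t; rewrite sqr_enorm.
Qed.

Lemma ae_noise_square_cvg : {ae Q, forall t, cvgn (series (fun k =>
  gamma k ^+ 2 * (edot (w_ k t) (w_ k t) + edot (wh_ k t) (wh_ k t))))}.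
Proof.
pose f k t :=
  gamma k ^+ 2 * (edot (w_ k t) (w_ k t) + edot (wh_ k t) (wh_ k t)).
have iD k : Q.-integrable setT
    (EFin \o (fun t => edot (w_ k t) (w_ k t) + edot (wh_ k t) (wh_ k t))).
  by apply: integrable_add; [have [] := w2T k|have [] := wh2T k].
apply: (ae_series_cvg Q f (fun k => gamma k ^+ 2 * (nu ^+ 2 + nu ^+ 2))).
- by move=> k t; rewrite mulr_ge0 ?sqr_ge0// addr_ge0 ?edot_ge0.
- by move=> k; exact: integrable_scale.
- move=> k; have [iw wn] := w2T k; have [iwh whn] := wh2T k.
  by rewrite RintegralZl// ler_wpM2l ?sqr_ge0// RintegralD// lerD.
have -> : (fun k => gamma k ^+ 2 * (nu ^+ 2 + nu ^+ 2)) =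
    (nu ^+ 2 + nu ^+ 2) *: (fun k => gamma k ^+ 2).
  by apply/funext => k; rewrite mulrC.
exact: is_cvg_seriesZ.
Qed.

(** The weighted noise is a martingale for the half-step histories: the weight
    is a function of [x_ k], known at the half step, and [wh_ k] is
    conditionally centered. Only boundedness of the weights is used, so that no
    moment of [x0] is needed. *)
Lemma ae_noise_cvg (phi : 'rV[R]_n -> 'rV[R]_n) (C : R) :
  (forall i, measurable_fun setT ((fun u => phi u 0 i) : borelV R n -> R)) ->
  (forall u i, `|phi u 0 i| <= C) ->
  {ae Q, forall t, noise_cvg gamma (x_ ^~ t) (wh_ ^~ t) phi}.
Proof.
move=> mphi phiC; apply: filter_forall => i.
pose g k := history_half_gen x0 om omh k.
pose z k t := gamma k * phi (x_ k t) 0 i.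
pose D k t := z k t * wh_ k t 0 i.
have gS k : <<s g k >> `<=` <<s g k.+1 >>.
  exact: subset_trans (history_half_sub x0 om omh k)
    (history_sub_half x0 om omh k.+1).
have mz k : measurable_fun setT (z k : g_sigma_algebraType (g k) -> R).
  apply: measurable_funM => //.
  have mx :
      measurable_fun setT (x_ k : g_sigma_algebraType (g k) -> borelV R n).
    apply: measurable_fun_g_sigma_sub (history_sub_half x0 om omh k) _.
    exact: measurable_esa.
  exact: measurableT_comp (mphi i) mx.
have mwh k : measurable_fun setT
    ((fun t => wh_ k t 0 i) : g_sigma_algebraType (g k.+1) -> R).
  apply: measurable_fun_g_sigma_sub (history_sub_half x0 om omh k.+1) _.
  exact: measurable_noise_half.
have zC k t : `|z k t| <= `|gamma k| * C by rewrite normrM ler_wpM2l.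
have mzT k := measurable_fun_g_sigma_measurable (g k) (z k) (HhT k) (mz k).
have w0 k : cond_mean0 Q (g k) (fun t => wh_ k t 0 i).
  exact: cond_expectation_as_mean0 (HhT k) _ (wh0 k i).
have iwi2 k : Q.-integrable setT (EFin \o (fun t => wh_ k t 0 i ^+ 2)).
  have [iwh _] := wh2T k; apply: le_integrable iwh => //.
    apply/measurable_EFinP; apply: measurable_funX.
    exact: measurable_fun_g_sigma_measurable (HhT k.+1) (mwh k).
  move=> t _ /=; rewrite lee_fin !ger0_norm ?sqr_ge0 ?edot_ge0//.
  exact: sqr_coord_le_edot.
have DE k : (fun t => D k t ^+ 2) = (fun t => z k t ^+ 2 * wh_ k t 0 i ^+ 2).
  by apply/funext => t; rewrite exprMn.
have z2C k t : `|z k t ^+ 2| <= gamma k ^+ 2 * C ^+ 2.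
  rewrite normrX -[gamma k ^+ 2]ger0_norm ?sqr_ge0// normrX -exprMn.
  by rewrite ler_sqr ?nnegrE// (le_trans _ (zC k t)).
have mz2 k : measurable_fun setT (fun t => z k t ^+ 2).
  exact: measurable_funX.
have iD2 k := integrable_bounded_mul _ _ _ _ (mz2 k) (z2C k) (iwi2 k).
apply: (martingale_cvg Q g D (fun k => C ^+ 2 * nu ^+ 2 * gamma k ^+ 2)) => //.
- move=> k; apply: measurable_funM => //.
  exact: measurable_fun_g_sigma_sub (gS k) (mz k).
- move=> k; have [iw _] := w0 k; split.
    exact: (integrable_bounded_mul Q (z k) _ _ (mzT k) (zC k) iw).
  move=> A gA; rewrite Rintegral_mkcond.
  rewrite (_ : _ \_ A = fun t => (\1_A t * z k t) * wh_ k t 0 i); last first.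
    apply/funext => t; rewrite patchE indicE.
    by case: (t \in A); rewrite ?mul1r ?mul0r.
  apply: (cond_mean0_mul _ _ _ (HhT k) (w0 k) _ (`|gamma k| * C)).
    by apply: measurable_funM.
  move=> t; rewrite normrM -[leRHS]mul1r ler_pM//.
  by rewrite indicE; case: (t \in A); rewrite ?normr1 ?normr0.
- by move=> k; rewrite DE.
- move=> k; rewrite DE.
  have [iwh whn] := wh2T k.
  apply: (@le_trans _ _
      (\int[Q]_t ((gamma k ^+ 2 * C ^+ 2) * edot (wh_ k t) (wh_ k t)))).
    apply: le_Rintegral => //; first exact: integrable_scale.
    move=> t _; apply: ler_pM; rewrite ?sqr_ge0//.
      exact: le_trans (ler_norm _) (z2C k t).
    exact: sqr_coord_le_edot.
  have -> : C ^+ 2 * nu ^+ 2 * gamma k ^+ 2 =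
    gamma k ^+ 2 * C ^+ 2 * nu ^+ 2 by ring.
  have gC0 : 0 <= gamma k ^+ 2 * C ^+ 2 by rewrite mulr_ge0 ?sqr_ge0.
  rewrite RintegralZl//; exact: ler_wpM2l.
have -> : (fun k => C ^+ 2 * nu ^+ 2 * gamma k ^+ 2) =
    (C ^+ 2 * nu ^+ 2) *: (fun k => gamma k ^+ 2) by [].
exact: is_cvg_seriesZ.
Qed.


(** The three families of weights used by the pathwise argument. *)
Lemma ae_noise_cvg_all (xs : 'rV[R]_n) : {ae Q, forall t,
  [/\ noise_cvg gamma (x_ ^~ t) (wh_ ^~ t) (damped xs),
      noise_cvg gamma (x_ ^~ t) (wh_ ^~ t) (fun=> const_mx 1) &
      forall N : nat, noise_cvg gamma (x_ ^~ t) (wh_ ^~ t) (clamp N%:R)]}.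
Proof.
have damped_cvg : {ae Q, forall t,
    noise_cvg gamma (x_ ^~ t) (wh_ ^~ t) (damped xs)}.
  have den_gt0 u : 0 < 1 + edot (u - xs) (u - xs) by rewrite ltr_pwDl ?edot_ge0.
  apply: (ae_noise_cvg _ 1) => [i|u i].
    apply: continuous_borel_real => u.
    rewrite (_ : (fun v => _) =
        (fun v => (1 + edot (v - xs) (v - xs))^-1 * (v 0 i - xs 0 i)));
      last first.
      by apply/funext => v; rewrite !mxE.
    suff h (H : set_system 'rV[R]_n) (FH : Filter H) : id @ H --> u ->
        (fun v => (1 + edot (v - xs) (v - xs))^-1 * (v 0 i - xs 0 i)) @ H -->
        (1 + edot (u - xs) (u - xs))^-1 * (u 0 i - xs 0 i).
      exact: (h (nbhs u) (nbhs_filter u) (@cvg_id _ (nbhs u))).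
    move=> Hu; apply: cvgM.
      apply: cvgV; first by rewrite gt_eqF.
      by apply: cvgD; [exact: cvg_cst|exact: (cvg_sqdist id u xs Hu)].
    apply: cvgB; last exact: cvg_cst.
    apply: (cvg_comp _ (fun v : 'rV[R]_n => v 0 i) Hu).
    exact: (@coord_continuous R 1 n 0 i u).
  have := sqr_coord_le_edot (u - xs) i; rewrite /damped !mxE => le_i.
  rewrite normrM ger0_norm ?invr_ge0 ?(ltW (den_gt0 u))//.
  rewrite mulrC ler_pdivrMr// mul1r; apply: le1D_of_sqr_le.
  by rewrite -normrX ger0_norm ?sqr_ge0.
have one_cvg : {ae Q, forall t,
    noise_cvg gamma (x_ ^~ t) (wh_ ^~ t) (fun=> const_mx 1)}.
  apply: (ae_noise_cvg _ 1) => [i|u i]; last by rewrite mxE normr1.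
  by apply: continuous_borel_real => u; exact: cst_continuous.
have clamp_cvg : {ae Q, forall t, forall N : nat,
    noise_cvg gamma (x_ ^~ t) (wh_ ^~ t) (clamp N%:R)}.
  apply: ae_foralln => N; apply: (ae_noise_cvg _ N%:R) => [i|u i].
    rewrite (_ : (fun v => _) =
        (cst (- N%:R) \max (cst N%:R \min (fun v : 'rV[R]_n => v 0 i)))).
      apply: measurable_maxr => //; apply: measurable_minr => //.
      exact: measurable_coord.
    by apply/funext => v; rewrite mxE.
  rewrite mxE ler_norml le_max lexx/= ge_max ge_min lexx/= andbT.
  by rewrite ge0_cp ?ler0n.
apply: filterS3 damped_cvg one_cvg clamp_cvg => t; by split.
Qed.

End noise.

Theorem proposition2 (R : realType) (n d : nat)
  (* the random map F(x; w) = F x (xi w) *)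
  (dO : measure_display) (Om : measurableType dO) (P : probability Om R)
  (xi : Om -> 'rV[R]_d) (X : set 'rV[R]_n)
  (F : 'rV[R]_n -> 'rV[R]_d -> 'rV[R]_n)
  (* the run of the scheme *)
  (dT : measure_display) (T : measurableType dT) (Q : probability T R)
  (x0 : T -> 'rV[R]_n) (om omh : nat -> T -> Om) (gamma : nat -> R) :
  let G := fun x w => F x (xi w) in
  let Fm := mean_map P G in
  let x_ := esa P X G gamma x0 om omh in
  let w_ := esa_noise P X G gamma x0 om omh in
  let wh_ := esa_noise_half P X G gamma x0 om omh in
  let H_ := history x0 om omh in
  let Hh_ := history_half x0 om omh in
  X !=set0 -> closed X -> convex_set X ->
  measurable_fun setT (xi : Om -> borelV R d) ->
  @measurable_fun _ _ (borelV R n * borelV R d)%type (borelV R n)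
    (X `*` setT) (fun p => F p.1 p.2) ->
  (forall x i, X x -> P.-integrable setT (fun w => (G x w 0 i)%:E)) ->
  measurable_fun setT (x0 : T -> borelV R n) ->
  (forall t, X (x0 t)) ->
  (forall k, measurable_fun setT (om k)) ->
  (forall k, measurable_fun setT (omh k)) ->
  (forall k, 0 < gamma k) -> gamma @ \oo --> (0 : R) ->
  {within X, continuous Fm} ->
  svi_sol X Fm !=set0 ->
  (* (A1) *)
  (forall k i,
     cond_expectation_as Q (H_ k) (fun t => w_ k t 0 i) [set y | y = 0] /\
     cond_expectation_as Q (Hh_ k) (fun t => wh_ k t 0 i) [set y | y = 0]) ->
  (* (A2) *)
  (exists2 nu : R, 0 < nu & forall k,
     cond_expectation_as Q (H_ k) (fun t => enorm (w_ k t) ^+ 2)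
       [set y | y <= nu ^+ 2] /\
     cond_expectation_as Q (Hh_ k) (fun t => enorm (wh_ k t) ^+ 2)
       [set y | y <= nu ^+ 2]) ->
  (* (A3) *)
  (\sum_(0 <= k <oo) (gamma k ^+ 2)%:E < +oo)%E ->
  (* (A4) *)
  (\sum_(0 <= k <oo) (gamma k)%:E = +oo)%E ->
  (* (A5) *)
  lipschitz_bounded X Fm ->
  [\/ acute_angle X Fm,
      strictly_pseudomonotone X Fm,
      strongly_pseudomonotone X Fm |
      pseudomonotone X Fm /\ is_gradient_of_mean P G X] ->
  {ae Q, forall t,
     bounded_set (range (fun k => x_ k t)) /\
     cluster ((fun k => x_ k t) @ \oo) `<=` svi_sol X Fm}.
Proof.
move=> G Fm x_ w_ wh_ H_ Hh_ X0 Xcl Xconv mxi mF _ mx0 Xx0 mom momh g0 _ Fc.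
move=> [xs xsol] A1 [nu nu0 A2] g2 gd [L [B [L0 B0 FL FB]]] monotone.
have acute : acute_angle X Fm.
  case: monotone => [//|||[pm [f [U [_ _ _ fF]]]]].
  - exact: strictly_pseudomonotone_acute.
  - by move=> sm; apply: strictly_pseudomonotone_acute;
      exact: strongly_pseudomonotone_strictly.
  - exact: (pseudomonotone_gradient_acute _ _ Xconv Fc _ fF pm).
have {}g2 : cvgn (series (fun k => gamma k ^+ 2)).
  by apply: nnseries_is_cvg => // k; exact: sqr_ge0.
have {}gd : ~ cvgn (series gamma).
  move=> gc; move: gd; rewrite (_ : (fun k => _) = EFin \o series gamma).
    by rewrite EFin_lim.
  by apply/funext => k; rewrite /= /series/= sumEFin.
have noise2 : {ae Q, forall t, cvgn (series (fun k =>
    gamma k ^+ 2 * (edot (w_ k t) (w_ k t) + edot (wh_ k t) (wh_ k t))))}.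
  by apply: (ae_noise_square_cvg P xi X F Q x0 om omh gamma nu) => // k;
    have [] := A2 k.
have noise : {ae Q, forall t,
    [/\ noise_cvg gamma (x_ ^~ t) (wh_ ^~ t) (damped xs),
        noise_cvg gamma (x_ ^~ t) (wh_ ^~ t) (fun=> const_mx 1) &
        forall N : nat, noise_cvg gamma (x_ ^~ t) (wh_ ^~ t) (clamp N%:R)]}.
  apply: (ae_noise_cvg_all P xi X F Q x0 om omh gamma nu) => // [k i|k].
    by have [] := A1 k i.
  by have [] := A2 k.
apply: filterS2 noise2 noise => t noise2 [dampedc onec clampc].
have [|||z zsol xz] := run_limit X Fm X0 Xcl Xconv L B FL FB gamma (x_ ^~ t)
  (fun k => esa_half P X G gamma x0 om omh k t) (w_ ^~ t) (wh_ ^~ t)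
  g0 g2 gd _ _ _ noise2 Fc acute onec clampc xs xsol dampedc.
- exact: Xx0.
- by [].
- by [].
split.
  have [M [Mreal xM]] := cvg_seq_bounded (cvgP _ xz).
  by exists M; split => // r Mr _ [k _ <-]; exact: xM.
move=> y /(cvg_cluster xz) yz.
by rewrite -(norm_hausdorff yz).
Qed.
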